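(* Let $d\ge1$ be an integer, let $G$ be either $\mathbb{Z}^d$ or $\mathbb{N}_0^d$, let $F$ be a finite set with at least $2$ elements, and let $\Sigma=F^G$. There is a Lipschitz continuous potential $\varphi_0\colon\Sigma\to\mathbb{R}$ and complementary open subsets $U^+$ and $U^-$ of $\Sigma$ such that for every sequence of positive numbers $(\widehat{\beta}_\ell)_{\ell\in\mathbb{N}}$ satisfying $\widehat{\beta}_\ell\to+\infty$ as $\ell\to+\infty$, the following property holds: for every $\varepsilon>0$ there is a Lipschitz continuous function $\varphi\colon\Sigma\to\mathbb{R}$ with $\|\varphi-\varphi_0\|_{\mathrm{Lip}}<\varepsilon$ such that, if for each $\ell$ we choose an arbitrary translation invariant Gibbs measure $\rho_\ell$ for the potential $\widehat{\beta}_\ell\cdot\varphi$, then the sequence $(\rho_\ell)_{\ell\in\mathbb{N}}$ accumulates (in the weak* topology) at the same time on a measure supported on $U^+$ and on a measure supported on $U^-$.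
   Context: $\mathbb{N}=\{1,2,\dots\}$, $\mathbb{N}_0=\{0,1,2,\dots\}$. $\Sigma=F^G$ is endowed with the distance $\mathrm{dist}((\theta_n)_{n\in G},(\theta'_n)_{n\in G})=2^{-\min\{\|n\|:\theta_n\ne\theta'_n\}}$ for distinct elements, where $\|\cdot\|$ is the sup-norm. $\sigma$ denotes the action of $G$ on $\Sigma$ by translations; $\mathcal{M}_\sigma$ is the space of $\sigma$-invariant Borel probability measures on $\Sigma$ with the weak* topology; $h_\nu$ is the measure-theoretic entropy of $\nu\in\mathcal{M}_\sigma$. For continuous $\varphi\colon\Sigma\to\mathbb{R}$, the pressure is $P(\varphi)=\sup\{h_\nu+\int\varphi\,d\nu:\nu\in\mathcal{M}_\sigma\}$. An equilibrium state for $\varphi$ is a measure $\nu \in \mathcal{M}_\sigma$ attaining this supremum; throughout, ''translation invariant Gibbs measure for the potential $\varphi$'' means equilibrium state for $\varphi$. $\|\varphi\|_{\mathrm{Lip}}=\sup_{x}|\varphi(x)|+\sup_{x\ne x'}\frac{|\varphi(x)-\varphi(x')|}{\mathrm{dist}(x,x')}$, and $\varphi$ is Lipschitz continuous if $\|\varphi\|_{\mathrm{Lip}}<+\infty$. Two subsets of $\Sigma$ are complementary if each is the complement of the other. *)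

(* Defs.v *)
From HB Require Import structures.
From mathcomp Require Import all_boot all_order all_algebra.
From mathcomp Require Import all_classical all_reals all_analysis.

Set Implicit Arguments.
Unset Strict Implicit.
Unset Printing Implicit Defensive.

Import Order.TTheory GRing.Theory Num.Theory.
Import numFieldTopology.Exports numFieldNormedType.Exports.

Local Open Scope classical_set_scope.
Local Open Scope ring_scope.

Variant lattice_kind := FullLattice | Orthant.

Definition coord (k : lattice_kind) : nzSemiRingType :=
  match k with FullLattice => int | Orthant => nat end.

Definition coord_abs (k : lattice_kind) : coord k -> nat :=
  match k with FullLattice => absz | Orthant => id end.

(* [site FullLattice d] is the group Z^d, [site Orthant d] is the monoid N_0^d. *)
Definition site (k : lattice_kind) (d : nat) : nmodType := {ffun 'I_d -> coord k}.

Definition site_norm (k : lattice_kind) (d : nat) (s : site k d) : nat :=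
  (\max_(i < d) coord_abs ((s : {ffun 'I_d -> coord k}) i))%N.

Definition box_site (k : lattice_kind) (d n : nat) (v : {ffun 'I_d -> 'I_n}) :
  site k d := [ffun i => (v i : nat)%:R].

(* The full shift F^G. The field R and the proof F2 are parameters of the type
   only so that its R-valued metric and a point of it can be inferred. *)
Definition config (R : realType) (k : lattice_kind) (d : nat) (F : finType)
  (F2 : (1 < #|F|)%N) : Type := site k d -> F.

Section Shift.
Context {R : realType} {k : lattice_kind} {d : nat} {F : finType}.
Context {F2 : (1 < #|F|)%N}.

Local Notation Sigma := (config R k d F2).

HB.instance Definition _ := Choice.copy Sigma (site k d -> F).
HB.instance Definition _ := isPointed.Build Sigma
  (fun=> enum_val (Ordinal (ltnW F2))).

Implicit Types x y z : Sigma.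

Definition differ_at x y (n : nat) : bool :=
  `[< exists2 s : site k d, site_norm s = n & x s <> y s >].

(* 2^-min {|s| : x s <> y s}, and 0 if x = y. *)
Definition config_dist x y : R :=
  match pselect (exists n, differ_at x y n) with
  | left h => 2 ^- ex_minn h
  | right _ => 0
  end.

Lemma differ_exP x y : (exists n, differ_at x y n) <-> x <> y.
Proof.
split=> [[n /asboolP[s _ xys]] xy|xy]; first by apply: xys; rewrite xy.
apply: contrapT => nxy; apply: xy; apply/funext => s.
apply: contrapT => xys; apply: nxy; exists (site_norm s).
by apply/asboolP; exists s.
Qed.

Lemma config_distxx x : config_dist x x = 0.
Proof.
by rewrite /config_dist; case: pselect => // h; have /differ_exP[] := h.
Qed.

Lemma config_dist_ge0 x y : 0 <= config_dist x y.
Proof.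
by rewrite /config_dist; case: pselect => // h; rewrite invr_ge0 exprn_ge0.
Qed.

Lemma config_dist_pos x y : config_dist x y = 0 -> x = y.
Proof.
rewrite /config_dist; case: pselect => [h|h _].
  by move/eqP; rewrite invr_eq0 expf_eq0 pnatr_eq0 andbF.
by apply: contrapT => xy; apply/h/differ_exP.
Qed.

Lemma config_dist_ge x y (s : site k d) : x s <> y s ->
  2 ^- site_norm s <= config_dist x y.
Proof.
move=> xys; have dxy : differ_at x y (site_norm s) by apply/asboolP; exists s.
rewrite /config_dist; case: pselect => [h|[]]; last by exists (site_norm s).
case: ex_minnP => m _ /(_ _ dxy) ms.
by rewrite lef_pV2 ?posrE ?exprn_gt0// ler_weXn2l// ler1n.
Qed.

Lemma config_distC x y : config_dist x y = config_dist y x.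
Proof.
suff H u v : config_dist u v <= config_dist v u by apply/le_anti; rewrite !H.
rewrite {1}/config_dist; case: pselect => [h|_]; last exact: config_dist_ge0.
case: ex_minnP => m /asboolP[s <- uvs] _.
by apply: config_dist_ge => vus; apply: uvs.
Qed.

Lemma config_dist_triangle y x z :
  config_dist x z <= config_dist x y + config_dist y z.
Proof.
rewrite {1}/config_dist; case: pselect => [h|_]; last first.
  by rewrite addr_ge0 ?config_dist_ge0.
case: ex_minnP => m /asboolP[s <- xzs] _.
have [xys|xys] := pselect (x s = y s).
  by rewrite ler_wpDl ?config_dist_ge0// config_dist_ge// -xys.
by rewrite ler_wpDr ?config_dist_ge0// config_dist_ge.
Qed.

HB.instance Definition _ := @isMetric.Build R Sigma config_dist
  config_distxx config_dist_pos config_distC config_dist_triangle.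

HB.instance Definition _ := Measurable.copy Sigma
  (g_sigma_algebraType (@open Sigma)).

Definition translate (g : site k d) x : Sigma := fun s => x (g + s).

Definition translation_invariant (nu : probability Sigma R) : Prop :=
  forall (g : site k d) (A : set Sigma), measurable A ->
    nu (translate g @^-1` A) = nu A.

Record invariant_measure := InvariantMeasure {
  invariant_probability :> probability Sigma R;
  invariant_probabilityP : translation_invariant invariant_probability }.

HB.instance Definition _ := gen_eqMixin invariant_measure.
HB.instance Definition _ := gen_choiceMixin invariant_measure.

Definition integral_pairing (nu : invariant_measure) :
    {ptws continuousType Sigma R -> R} :=
  fun f => (\int[nu]_x f x)%R.

(* The weak* topology: the coarsest one for which nu |-> \int f dnu is
   continuous for every continuous f. *)
HB.instance Definition _ := Topological.copy invariant_measure
  (initial_topology integral_pairing).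

Local Open Scope ereal_scope.

(* The entropy of the join of the translates of the partition A over the box
   {0, ..., n-1}^d; [ln 0 = 0], so that null atoms do not contribute. *)
Definition box_entropy (nu : invariant_measure) (m : nat)
    (A : 'I_m -> set Sigma) (n : nat) : R :=
  (\sum_(w : {ffun {ffun 'I_d -> 'I_n} -> 'I_m})
    let p := fine (nu (\bigcap_v (translate (box_site k v) @^-1` A (w v)))) in
    - (p * ln p))%R.

Definition partition_entropy (nu : invariant_measure) (m : nat)
    (A : 'I_m -> set Sigma) : R :=
  lim ((box_entropy nu A n / n%:R ^+ d)%R @[n --> \oo]).

Definition entropy (nu : invariant_measure) : \bar R :=
  ereal_sup [set h | exists (m : nat) (A : 'I_m -> set Sigma),
    [/\ forall i, measurable (A i), partition [set: 'I_m] A [set: Sigma] &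
        h = (partition_entropy nu A)%:E]].

Definition free_energy (phi : Sigma -> R) (nu : invariant_measure) : \bar R :=
  entropy nu + \int[nu]_x (phi x)%:E.

Definition pressure (phi : Sigma -> R) : \bar R :=
  ereal_sup [set free_energy phi nu | nu in [set: invariant_measure]].

Definition equilibrium_state (phi : Sigma -> R) (nu : invariant_measure) : Prop :=
  free_energy phi nu = pressure phi.

Definition lip_norm (phi : Sigma -> R) : \bar R :=
  ereal_sup [set `|phi x|%:E | x in [set: Sigma]] +
  ereal_sup [set (`|phi xy.1 - phi xy.2| / mdist xy.1 xy.2)%:E |
             xy in [set xy : Sigma * Sigma | xy.1 <> xy.2]].

Definition lipschitz_continuous (phi : Sigma -> R) : Prop := lip_norm phi < +oo.

(* Only used for U open and closed, where a measure of mass one on U is the same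
   as a topological support contained in U. *)
Definition supported_on (U : set Sigma) (nu : invariant_measure) : Prop :=
  nu (~` U) = 0.

End Shift.

Arguments invariant_measure R k d {F} F2.

(* Main.v *)
(** Since the sequence of inverse temperatures is an arbitrary one
    tending to infinity, one can take [phi0 = 0] and a small [phi].
    Fix symbols [a <> b]. A configuration is sparse of period [N] with background
    [f] if, up to a translation of the lattice [N Z^d], all its sites outside that
    lattice carry [f]; if the sites of the lattice carry freely one of two symbols,
    the entropy is [ln 2 / N^d]. At level [j] a window of side [M j] is legal if it
    is sparse of period [2^(j+1)] with one background (the favoured one: [a] for
    even [j], [b] for odd [j]) or of period [2^(j+2)] with the other background.
    The legal sets decrease with [j], and the favoured background has [2^d] times
    more entropy than its competitor. The potential is [- c j] at a configuration
    whose first illegal level is [j]. The [c j] decrease so fast along a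
    subsequence [l j] that [beta (l j) * c j = ln #|F|] punishes illegal windows at
    level [j] while [beta (l j) * c j.+1] is negligible. Comparing the entropy of an
    equilibrium state, counted on windows of side [M j], with that of the random
    sparse configurations shows that the favoured background has density close
    to 1, so the equilibrium states approach alternately the two Dirac masses at
    the constant configurations [a] and [b]. *)

(* At inverse temperature [beta (l j)] the penalty is [ln #|F|], the maximal entropy per site: in
   the entropy bound for an equilibrium state the share of the illegal windows is cancelled exactly
   by their energy. As [(2 N)^d >= 2 N^d], a window with the wrong background earns at most half of
   the favoured rate. What remains is a linear inequality for the share of favoured windows, with an
   error small against that rate. The obstacle is that the measure used for comparison at level [j]
   must escape every earlier penalty, although at some earlier levels its background is the
   disfavoured one. The doubled period granted to the competitor is what lets those levels admit it.
   The entropy of an equilibrium state enters only through an upper bound by the entropy of one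
   window, valid for every side. So each level involves a single inverse temperature, and the
   conclusion holds for any choice of the equilibrium state there. The windows are fixed before the
   inverse temperatures; the Lipschitz norm is then made small by taking [beta (l j)] large against
   [2 ^ M j]. *)
Require Import Defs.
From HB Require Import structures.
From mathcomp Require Import all_boot all_order all_algebra.
From mathcomp Require Import all_classical all_reals all_analysis.
From mathcomp Require Import measurable_realfun ring lra zify.

Set Implicit Arguments.
Unset Strict Implicit.
Unset Printing Implicit Defensive.

Import Order.TTheory GRing.Theory Num.Theory.
Import numFieldTopology.Exports numFieldNormedType.Exports.

Local Open Scope classical_set_scope.
Local Open Scope ring_scope.

(** * Entropy of finite-valued random variables *)

Section FiniteEntropy.
Context {R : realType}.
Implicit Types T : finType.

Definition shannon T (p : T -> R) : R := \sum_t - (p t * ln (p t)).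

Definition push T T' (f : T -> T') (p : T -> R) (y : T') : R :=
  \sum_(x | f x == y) p x.

Lemma ln_le_sub1 (x : R) : 0 < x -> ln x <= x - 1.
Proof.
by move=> x0; rewrite -[X in ln X](subrK 1) addrC le_ln1Dx// ltrBrDl subrr.
Qed.

(** Apply [ln x <= x - 1] to [q t / p t] and sum. A total mass of [q] below 1 is allowed because the
    weights used later come from counting bounds; the last hypothesis keeps [ln (q t)] away from the
    default value at 0 wherever it counts. *)
Lemma gibbs T (p q : T -> R) :
  (forall t, 0 <= p t) -> \sum_t p t = 1 ->
  (forall t, 0 <= q t) -> \sum_t q t <= 1 ->
  (forall t, 0 < p t -> 0 < q t) ->
  shannon p <= \sum_t - (p t * ln (q t)).
Proof.
move=> p0 p1 q0 q1 pq; rewrite -subr_le0 -sumrB.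
apply: (@le_trans _ _ (\sum_t (q t - p t))); last first.
  by rewrite sumrB p1 subr_le0.
apply: ler_sum => t _; rewrite opprK addrC -mulrBr.
have := p0 t; rewrite le_eqVlt => /predU1P[<-|pt]; first by rewrite mul0r subr0.
rewrite -ln_div ?posrE ?pq//.
apply: le_trans (ler_wpM2l (ltW pt) (ln_le_sub1 _)) _; first by rewrite divr_gt0 ?pq.
by rewrite mulrBr mulr1 mulrC divfK// gt_eqF.
Qed.

Lemma push_ge0 T T' (f : T -> T') (p : T -> R) y :
  (forall t, 0 <= p t) -> 0 <= push f p y.
Proof. by move=> p0; rewrite sumr_ge0. Qed.

Lemma push_sum T T' (f : T -> T') (p : T -> R) (g : T' -> R) :
  \sum_y push f p y * g y = \sum_x p x * g (f x).
Proof.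
rewrite [RHS](partition_big f xpredT)//=; apply: eq_bigr => y _.
by rewrite mulr_suml; apply: eq_bigr => x /eqP ->.
Qed.

Lemma push_sum1 T T' (f : T -> T') (p : T -> R) :
  \sum_y push f p y = \sum_x p x.
Proof.
have := push_sum f p (fun=> 1); under eq_bigr do rewrite mulr1.
by move=> ->; under eq_bigr do rewrite mulr1.
Qed.

Lemma push_le T T' (f : T -> T') (p : T -> R) x :
  (forall t, 0 <= p t) -> p x <= push f p (f x).
Proof. by move=> p0; rewrite /push (bigD1 x)//= lerDl sumr_ge0. Qed.

(** Every point weighs at most as much as its fibre, and [ln] is monotone. *)
Lemma shannon_push_le T T' (f : T -> T') (p : T -> R) :
  (forall t, 0 <= p t) -> shannon (push f p) <= shannon p.
Proof.
move=> p0; rewrite /shannon !sumrN lerN2.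
rewrite (push_sum f p (fun y => ln (push f p y))).
apply: ler_sum => x _; have := p0 x; rewrite le_eqVlt => /predU1P[<-|px].
  by rewrite !mul0r.
have pf := push_le f x p0.
by rewrite ler_wpM2l// ler_ln// posrE (lt_le_trans px).
Qed.

(** Gibbs' inequality against the product of the two marginals; the version for finite families
    below uses the product of all of them. *)
Lemma shannon_pair_le T T' (p : T * T' -> R) :
  (forall t, 0 <= p t) -> \sum_t p t = 1 ->
  shannon p <= shannon (push fst p) + shannon (push snd p).
Proof.
move=> p0 p1; set q1 := push fst p; set q2 := push snd p.
have q10 t : 0 <= q1 t by exact: push_ge0.
have q20 t : 0 <= q2 t by exact: push_ge0.
have pq t : 0 < p t -> 0 < q1 t.1 /\ 0 < q2 t.2.
  by move=> pt; split; apply: lt_le_trans pt _; apply: push_le.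
apply: le_trans (@gibbs _ p (fun t => q1 t.1 * q2 t.2) p0 p1 _ _ _) _.
- by move=> t; rewrite mulr_ge0 ?q10 ?q20.
- rewrite -(pair_bigA _ (fun i j => q1 i * q2 j))/=.
  by rewrite -big_distrlr/= !push_sum1 p1 mulr1.
- by move=> t /pq[? ?]; rewrite mulr_gt0.
rewrite /shannon !sumrN -opprD lerN2.
rewrite (push_sum fst p (fun y => ln (q1 y))) (push_sum snd p (fun y => ln (q2 y))).
rewrite -big_split/=; apply: ler_sum => t _.
have := p0 t; rewrite le_eqVlt => /predU1P[<-|/pq[? ?]].
  by rewrite !mul0r addr0.
by rewrite lnM ?posrE// mulrDr.
Qed.

Lemma ln_prod (I : finType) (g : I -> R) : (forall i, 0 < g i) ->
  ln (\prod_i g i) = \sum_i ln (g i).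
Proof.
(* Positivity of the product is carried through the same induction, as [lnM] asks for it. *)
move=> g0; apply: (proj2 (A := 0 < \prod_i g i)).
elim/big_ind2 : _ => [|x y u v [x0 <-] [u0 <-]|i _]; first by rewrite ln1.
- by rewrite mulr_gt0// lnM.
- by [].
Qed.

Lemma shannon_ffun_le (I : finType) T (p : {ffun I -> T} -> R) :
  (forall t, 0 <= p t) -> \sum_t p t = 1 ->
  shannon p <= \sum_i shannon (push (fun w : {ffun I -> T} => w i) p).
Proof.
move=> p0 p1; set q := fun i => push (fun w : {ffun I -> T} => w i) p.
have q0 i t : 0 <= q i t by apply: push_ge0.
have pq t i : 0 < p t -> 0 < q i (t i).
  by move=> pt; apply: lt_le_trans pt _; apply: (push_le (fun w : {ffun I -> T} => w i)).
apply: le_trans (@gibbs _ p (fun t => \prod_i q i (t i)) p0 p1 _ _ _) _.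
- by move=> t; rewrite prodr_ge0.
- by rewrite -(bigA_distr_bigA q) big1// => i _; rewrite push_sum1.
- by move=> t pt; rewrite prodr_gt0// => i _; exact: pq pt.
rewrite /shannon !sumrN.
under [in leRHS]eq_bigr do rewrite sumrN (push_sum _ p (fun y => ln (q _ y))).
rewrite sumrN lerN2 exchange_big/=; apply: ler_sum => t _.
have := p0 t; rewrite le_eqVlt => /predU1P[<-|pt].
  by rewrite mul0r big1// => i _; rewrite mul0r.
by rewrite ln_prod ?mulr_sumr// => i; exact: pq pt.
Qed.

(* Gibbs' inequality against the law giving weight [expR (- eps / 2)] to [t0]. *)
Lemma shannon_small T (eps : R) : 0 < eps -> exists2 delta : R, 0 < delta &
  forall (p : T -> R) t0, (forall t, 0 <= p t) -> \sum_t p t = 1 ->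
    1 - p t0 <= delta -> shannon p <= eps.
Proof.
move=> eps0; set a := expR (- (eps / 2)).
have a0 : 0 < a by exact: expR_gt0.
have a1 : a < 1 by rewrite expR_lt1 oppr_lt0 divr_gt0.
have [T0|T0] := posnP #|T|.
  by exists 1 => // p t0; have := max_card (pred1 t0); rewrite card1 T0.
set r := (1 - a) / #|T|%:R.
have r0 : 0 < r by rewrite divr_gt0 ?ltr0n ?subr_gt0.
(* The point [t0] costs at most [- ln a = eps / 2]; the other points share the mass [1 - p t0] and
   cost at most [- ln r] each per unit of mass. The [+ 1] keeps the denominator positive. *)
exists (eps / 2 / (`|ln r| + 1)); first by rewrite !divr_gt0// ltr_wpDl.
move=> p t0 p0 p1 pd.
have pt1 : p t0 <= 1 by rewrite -p1 (bigD1 t0)//= lerDl sumr_ge0.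
apply: le_trans (@gibbs _ p (fun t => if t == t0 then a else r) p0 p1 _ _ _) _.
- by move=> t; case: ifP => _; exact: ltW.
- rewrite (bigD1 t0)//= eqxx (eq_bigr (fun=> r)); last by move=> t /negbTE ->.
  rewrite sumr_const -mulr_natr addrC -lerBrDr /r -mulrA ler_piMr//; first by rewrite subr_ge0 ltW.
  by rewrite ler_pdivrMl ?ltr0n// mulr1 ler_nat max_card.
- by move=> t _; case: ifP.
rewrite (bigD1 t0)//= eqxx expRK mulrN opprK.
rewrite (eq_bigr (fun t => p t * - ln r)); last first.
  by move=> t /negbTE ->; rewrite mulrN.
have {}p1 : \sum_(t | t != t0) p t = 1 - p t0.
  by apply: (addrI (p t0)); rewrite addrC subrKC -p1 [RHS](bigD1 t0)//= addrC.
rewrite -mulr_suml p1 [leRHS](splitr eps) lerD//.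
  by rewrite ler_piMl// divr_ge0// ltW.
apply: (@le_trans _ _ ((1 - p t0) * (`|ln r| + 1))).
  by rewrite ler_wpM2l ?subr_ge0// ler_wpDr// -normrN ler_norm.
by rewrite -ler_pdivlMr// ltr_wpDl.
Qed.

(* Gibbs' inequality against the law that picks a class uniformly, then a point of
   the class with weight [1 / B c]. *)
Lemma shannon_class_le (T C : finType) (p : T -> R) (cl : T -> C) (B : C -> R) :
  (forall t, 0 <= p t) -> \sum_t p t = 1 ->
  (forall c, 0 < B c) -> (forall c, #|[pred t | cl t == c]|%:R <= B c) ->
  shannon p <= ln #|C|%:R + \sum_c push cl p c * ln (B c).
Proof.
move=> p0 p1 B0 HB.
have C0 : 0 < #|C|%:R :> R.
  rewrite ltr0n; apply/card_gt0P.
  have [t _|nT] := pickP (fun _ : T => true); first by exists (cl t).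
  by move: p1; rewrite big_pred0// => /eqP; rewrite eq_sym oner_eq0.
apply: le_trans (@gibbs _ p (fun t => (#|C|%:R * B (cl t))^-1) p0 p1 _ _ _) _.
- by move=> t; rewrite invr_ge0 mulr_ge0// ltW.
- rewrite (partition_big cl xpredT)//=.
  apply: (@le_trans _ _ (\sum_(c : C) #|C|%:R^-1)); last first.
    by rewrite sumr_const -[X in X <= _]mulr_natr mulVf// gt_eqF.
  apply: ler_sum => c _.
  rewrite (eq_bigr (fun=> (#|C|%:R * B c)^-1)); last by move=> t /eqP ->.
  rewrite sumr_const -[X in X <= _]mulr_natr invfM -mulrA ler_piMr//.
  by rewrite ler_pdivrMl// mulr1; exact: HB.
- by move=> t _; rewrite invr_gt0 mulr_gt0.
have {1}-> : ln #|C|%:R = \sum_t p t * ln #|C|%:R by rewrite -mulr_suml p1 mul1r.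
rewrite push_sum -big_split/=.
apply: ler_sum => t _; rewrite lnV ?posrE ?mulr_gt0// mulrN opprK lnM ?posrE//.
by rewrite mulrDr.
Qed.

Lemma shannon_ge (T : finType) (p : T -> R) m :
  (forall t, 0 <= p t) -> \sum_t p t = 1 -> (forall t, p t <= 2 ^- m) ->
  m%:R * ln 2 <= shannon p.
Proof.
move=> p0 p1 pm; have -> : m%:R * ln 2 = \sum_t p t * (m%:R * ln 2) by rewrite -mulr_suml p1 mul1r.
apply: ler_sum => t _.
have := p0 t; rewrite le_eqVlt => /predU1P[<-|pt]; first by rewrite !mul0r oppr0.
rewrite -mulrN ler_wpM2l// lerNr mulr_natl -lnXn// -lnV ?posrE ?exprn_gt0//.
by rewrite ler_ln ?posrE ?invr_gt0 ?exprn_gt0.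
Qed.

End FiniteEntropy.

Section FiniteValued.
Context {R : realType} {disp : measure_display} {X : measurableType disp}.
Variable P : probability X R.
Implicit Types T : finType.

(** Measurability expressed on fibres, which avoids equipping [T] with a sigma-algebra. *)
Definition finite_valued T (f : X -> T) :=
  forall t, measurable (f @^-1` [set t]).

Definition law T (f : X -> T) (t : T) : R := fine (P (f @^-1` [set t])).

Lemma fine_prob (A : set X) : measurable A -> (fine (P A))%:E = P A.
Proof. by move=> mA; rewrite fineK// fin_num_measure. Qed.

Lemma fine_prob_ge0 (A : set X) : 0 <= fine (P A).
Proof. exact: fine_ge0. Qed.

Lemma fine_prob_le1 (A : set X) : measurable A -> fine (P A) <= 1.
Proof. by move=> mA; rewrite -lee_fin fine_prob// probability_le1. Qed.

Lemma le_fine_prob (A B : set X) : measurable A -> measurable B ->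
  A `<=` B -> fine (P A) <= fine (P B).
Proof. by move=> mA mB AB; rewrite -lee_fin !fine_prob// le_measure// inE. Qed.

Lemma fine_probU_le (A B : set X) : measurable A -> measurable B ->
  fine (P (A `|` B)) <= fine (P A) + fine (P B).
Proof.
move=> mA mB; rewrite -lee_fin EFinD !fine_prob//; last exact: measurableU.
exact: measureU2.
Qed.

Lemma fine_prob_bigsetU_le I (s : seq I) (B : I -> set X) :
  (forall i, measurable (B i)) ->
  fine (P (\big[setU/set0]_(i <- s) B i)) <= \sum_(i <- s) fine (P (B i)).
Proof.
move=> mB; elim: s => [|i s IH]; first by rewrite !big_nil measure0.
rewrite !big_cons; apply: le_trans (fine_probU_le _ _) _ => //.
  exact: bigsetU_measurable.
by rewrite lerD2l.
Qed.

Lemma law_ge0 T (f : X -> T) t : 0 <= law f t.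
Proof. exact: fine_prob_ge0. Qed.

Lemma preimage_mem0 T (f : X -> T) : f @^-1` [set t | t \in [::]] = set0.
Proof. by apply/seteqP; split. Qed.

Lemma preimage_mem_cons T (f : X -> T) a s :
  f @^-1` [set t | t \in a :: s] =
  f @^-1` [set a] `|` f @^-1` [set t | t \in s].
Proof.
apply/seteqP; split => x /=; rewrite in_cons.
  by case/predU1P; [left|right].
by case=> [->|->]; rewrite ?eqxx ?orbT.
Qed.

Lemma finite_valued_seq T (f : X -> T) (s : seq T) : finite_valued f ->
  measurable (f @^-1` [set t | t \in s]).
Proof.
move=> mf; elim: s => [|a s IH]; first by rewrite preimage_mem0.
by rewrite preimage_mem_cons; apply: measurableU.
Qed.

Lemma prob_law_seq T (f : X -> T) (s : seq T) : finite_valued f -> uniq s ->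
  fine (P (f @^-1` [set t | t \in s])) = \sum_(t <- s) law f t.
Proof.
move=> mf; elim: s => [|a s IH /= /andP[as_ us]].
  by rewrite preimage_mem0 measure0 big_nil.
rewrite big_cons -IH// preimage_mem_cons.
apply: EFin_inj; rewrite EFinD !fine_prob//; last 2 first.
- exact: finite_valued_seq.
- by apply: measurableU => //; exact: finite_valued_seq.
rewrite measureU//; first exact: finite_valued_seq.
by rewrite -preimage_setI; apply/seteqP; split => // x /= [-> xs]; rewrite xs in as_.
Qed.

Lemma preimage_filter T (f : X -> T) (S : pred T) :
  f @^-1` [set t | S t] = f @^-1` [set t | t \in [seq t <- enum T | S t]].
Proof. by apply/seteqP; split => x /=; rewrite mem_filter mem_enum andbT. Qed.

Lemma finite_valued_set T (f : X -> T) (S : pred T) : finite_valued f ->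
  measurable (f @^-1` [set t | S t]).
Proof. by move=> mf; rewrite preimage_filter; exact: finite_valued_seq. Qed.

Lemma prob_law T (f : X -> T) (S : pred T) : finite_valued f ->
  fine (P (f @^-1` [set t | S t])) = \sum_(t | S t) law f t.
Proof.
move=> mf; rewrite preimage_filter prob_law_seq//; last first.
  by apply: filter_uniq; exact: enum_uniq.
by rewrite big_filter big_enum_cond; apply: eq_bigl.
Qed.

Lemma law_sum T (f : X -> T) : finite_valued f -> \sum_t law f t = 1.
Proof.
move=> mf; rewrite -(@prob_law _ _ xpredT mf).
by rewrite (_ : _ @^-1` _ = setT) ?probability_setT//; apply/seteqP; split.
Qed.

Lemma finite_valued_comp T T' (f : X -> T) (g : T -> T') :
  finite_valued f -> finite_valued (g \o f).
Proof.
move=> mf y; rewrite (_ : _ @^-1` _ = f @^-1` [set t | g t == y]).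
  exact: finite_valued_set.
by apply/seteqP; split => x /= /eqP.
Qed.

Lemma law_comp T T' (f : X -> T) (g : T -> T') : finite_valued f ->
  law (g \o f) = push g (law f).
Proof.
move=> mf; apply/funext => y; rewrite /push -prob_law//; congr (fine (P _)).
by apply/seteqP; split => x /= /eqP.
Qed.

Definition rv_entropy T (f : X -> T) : R := shannon (law f).

Lemma rv_entropy_comp_le T T' (f : X -> T) (g : T -> T') : finite_valued f ->
  rv_entropy (g \o f) <= rv_entropy f.
Proof. by move=> mf; rewrite /rv_entropy law_comp// shannon_push_le//; exact: law_ge0. Qed.

Lemma finite_valued_pair T T' (f : X -> T) (g : X -> T') :
  finite_valued f -> finite_valued g -> finite_valued (fun x => (f x, g x)).
Proof.
move=> mf mg [t u]; rewrite (_ : _ @^-1` _ = f @^-1` [set t] `&` g @^-1` [set u]).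
  exact: measurableI.
by apply/seteqP; split => x /=; [case=> -> ->|case=> -> ->].
Qed.

Lemma rv_entropy_pair_le T T' (f : X -> T) (g : X -> T') :
  finite_valued f -> finite_valued g ->
  rv_entropy (fun x => (f x, g x)) <= rv_entropy f + rv_entropy g.
Proof.
move=> mf mg; have mfg := finite_valued_pair mf mg.
apply: le_trans (shannon_pair_le _ (law_sum mfg)) _; first exact: law_ge0.
by rewrite -!law_comp.
Qed.

Lemma finite_valued_ffun (I : finType) T (f : I -> X -> T) :
  (forall i, finite_valued (f i)) -> finite_valued (fun x => [ffun i => f i x]).
Proof.
move=> mf w.
rewrite (_ : _ @^-1` _ = \bigcap_(i in [set` enum I]) (f i @^-1` [set w i])).
  by rewrite bigcap_seq; apply: bigsetI_measurable => i _; exact: mf.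
apply/seteqP; split => x /=; first by move=> <- i _ /=; rewrite ffunE.
by move=> H; apply/ffunP => i; rewrite ffunE H//= mem_enum.
Qed.

Lemma rv_entropy_ffun_le (I : finType) T (f : I -> X -> T) :
  (forall i, finite_valued (f i)) ->
  rv_entropy (fun x => [ffun i => f i x]) <= \sum_i rv_entropy (f i).
Proof.
move=> mf; have mF := finite_valued_ffun mf.
apply: le_trans (shannon_ffun_le _ (law_sum mF)) _; first exact: law_ge0.
apply: ler_sum => i _; rewrite -law_comp// /rv_entropy.
by rewrite (_ : _ \o _ = f i)//; apply/funext => x /=; rewrite ffunE.
Qed.

End FiniteValued.

(** * Topology and measurable structure of the full shift *)

Section Sites.
Context {k : lattice_kind} {d : nat}.
Implicit Types s t : site k d.

Lemma site_addE s t i : ((s + t) : {ffun 'I_d -> Defs.coord k}) i =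
  (s : {ffun 'I_d -> Defs.coord k}) i + (t : {ffun 'I_d -> Defs.coord k}) i.
Proof. by rewrite ffunE. Qed.

Lemma coord_absD (a b : Defs.coord k) :
  (coord_abs (a + b) <= coord_abs a + coord_abs b)%N.
Proof. by case: k a b => /= a b; lia. Qed.

Lemma site_normD s t : (site_norm (s + t) <= site_norm s + site_norm t)%N.
Proof.
apply/bigmax_leqP => i _; rewrite site_addE (leq_trans (coord_absD _ _))//.
by apply: leq_add; apply: (leq_bigmax i).
Qed.

Lemma coord_absN (n : nat) : coord_abs (n%:R : Defs.coord k) = n.
Proof. by case: k; [exact: (congr1 absz (natz n))|exact: natn]. Qed.

Lemma box_siteE n (v : {ffun 'I_d -> 'I_n}) i :
  (box_site k v : {ffun 'I_d -> Defs.coord k}) i = (v i : nat)%:R.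
Proof. by rewrite ffunE. Qed.

Lemma box_site_norm n (v : {ffun 'I_d -> 'I_n}) : (site_norm (box_site k v) <= n)%N.
Proof. by apply/bigmax_leqP => i _; rewrite box_siteE coord_absN ltnW. Qed.

(** Boxes have nonnegative coordinates, so over the integers a ball fits in a box only after the
    translation by [- n]; over the naturals [t = 0] does. Later arguments on local events see only
    the existence of [t]. *)
Lemma coord_ball_box n : exists (t : Defs.coord k) (m : nat), forall c,
  (coord_abs c < n)%N -> exists u : 'I_m, c = t + (u : nat)%:R.
Proof.
case: k => /=.
  exists (- n%:Z), (n + n)%N => c cn.
  have h : (absz (c + n%:Z)%R < n + n)%N by lia.
  exists (Ordinal h); rewrite [_%:R](natz (absz (c + n%:Z))) /=; lia.
exists 0%N, n => c cn; exists (Ordinal cn).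
by rewrite [_%:R](natn c) add0r.
Qed.

Lemma site_ball_box n : exists (t : site k d) (m : nat), forall s,
  (site_norm s < n)%N -> exists v : {ffun 'I_d -> 'I_m}, s = t + box_site k v.
Proof.
have [t [m tm]] := coord_ball_box n; exists ([ffun=> t] : {ffun 'I_d -> Defs.coord k}), m.
move=> s sn.
have h i : exists u : 'I_m, (s : {ffun _ -> _}) i = t + (u : nat)%:R.
  apply: tm; apply: leq_ltn_trans sn.
  exact: (leq_bigmax (F := fun i => coord_abs ((s : {ffun 'I_d -> Defs.coord k}) i)) i).
have [u hu] := choice h.
by exists [ffun i => u i]; apply/ffunP => i; rewrite site_addE box_siteE !ffunE hu.
Qed.

Lemma box_siteD n m (u : {ffun 'I_d -> 'I_n}) (v : {ffun 'I_d -> 'I_m}) l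
    (w : {ffun 'I_d -> 'I_l}) : (forall i, (u i + v i = w i :> nat)%N) ->
  box_site k u + box_site k v = box_site k w.
Proof.
by move=> uvw; apply/ffunP => i; rewrite site_addE !box_siteE -natrD uvw.
Qed.

End Sites.

Section Topology.
Context {R : realType} {k : lattice_kind} {d : nat} {F : finType}.
Context {F2 : (1 < #|F|)%N}.
Local Notation Sigma := (config R k d F2).
Implicit Types (x y : Sigma) (g s t : site k d).

Definition agree (n : nat) x y := forall s, (site_norm s < n)%N -> x s = y s.

Lemma agree_sym n x y : agree n x y -> agree n y x.
Proof. by move=> xy s sn; rewrite xy. Qed.

Lemma agree_trans n y x z : agree n x y -> agree n y z -> agree n x z.
Proof. by move=> xy yz s sn; rewrite xy// yz. Qed.

Lemma agree_le n m x y : (m <= n)%N -> agree n x y -> agree m x y.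
Proof. by move=> mn xy s sm; rewrite xy// (leq_trans sm). Qed.

Lemma agree_mdist n x y : agree n x y -> mdist x y <= 2 ^- n.
Proof.
rewrite /mdist/= /config_dist => xy; case: pselect => [h|_]; last first.
  by rewrite invr_ge0 exprn_ge0.
case: ex_minnP => m /asboolP[s sm xys] _.
rewrite lef_pV2 ?posrE ?exprn_gt0// ler_weXn2l ?ler1n// leqNgt.
by apply/negP => mn; apply: xys; apply: xy; rewrite sm.
Qed.

Lemma mdist_agree n x y : mdist x y < 2 ^- n -> agree n x y.
Proof.
move=> xyn s sn; apply: contrapT => /config_dist_ge; apply/negP.
rewrite -ltNge (lt_le_trans xyn)//.
by rewrite lef_pV2 ?posrE ?exprn_gt0// ler_weXn2l ?ler1n// ltnW.
Qed.

Lemma ball_agree x (e : R) : 0 < e -> exists n, forall y, agree n x y -> ball x e y.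
Proof.
move=> e0; exists (Num.truncn e^-1).+1 => y /agree_mdist xyn.
rewrite ballEmdist/= (le_lt_trans xyn)//.
rewrite -[ltRHS]invrK ltf_pV2 ?posrE ?exprn_gt0 ?invr_gt0//.
apply: (@lt_trans _ _ (Num.truncn e^-1).+1%:R); last by rewrite -natrX ltr_nat ltn_expl.
exact: Num.Theory.truncnS_gt.
Qed.

Lemma nbhs_agree x (A : set Sigma) :
  nbhs x A <-> exists n, forall y, agree n x y -> A y.
Proof.
split=> [/nbhs_ballP[e /= e0 eA]|[n nA]].
  by have [n xn] := ball_agree x e0; exists n => y /xn /eA.
apply/nbhs_ballP; exists (2 ^- n) => /=; first by rewrite invr_gt0 exprn_gt0.
by move=> y; rewrite ballEmdist/= => /mdist_agree /nA.
Qed.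

Lemma open_agree (A : set Sigma) :
  open A <-> forall x, A x -> exists n, forall y, agree n x y -> A y.
Proof.
rewrite openE; split=> H x /H; first by move/nbhs_agree.
by move=> Hx; apply/nbhs_agree.
Qed.

(** For all [n] together these sets form the algebra of cylinder events, whose members are open and
    closed. *)
Definition determined (n : nat) (A : set Sigma) :=
  forall x y, agree n x y -> A x -> A y.

Lemma determined_open n A : determined n A -> open A.
Proof. by move=> dA; apply/open_agree => x Ax; exists n => y /dA; apply. Qed.

Lemma open_measurable_config (A : set Sigma) : open A -> measurable A.
Proof. by move=> oA; apply: sub_sigma_algebra. Qed.

Lemma determined_measurable n A : determined n A -> measurable A.
Proof. by move/determined_open/open_measurable_config. Qed.

Lemma determined_le n m A : (m <= n)%N -> determined m A -> determined n A.
Proof. by move=> mn dA x y /(agree_le mn) /dA. Qed.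

Lemma determinedC n A : determined n A -> determined n (~` A).
Proof. by move=> dA x y xy nAx Ay; apply/nAx/(dA y) => //; exact: agree_sym. Qed.

Lemma determinedU n A B : determined n A -> determined n B -> determined n (A `|` B).
Proof. by move=> dA dB x y xy [/(dA _ _ xy)|/(dB _ _ xy)]; [left|right]. Qed.

Definition open_core (A : set Sigma) (n : nat) : set Sigma :=
  [set x | forall y, agree n x y -> A y].

Lemma open_core_determined A n : determined n (open_core A n).
Proof. by move=> x y xy Ax z yz; apply: Ax; apply: agree_trans yz. Qed.

Lemma open_core_homo A : nondecreasing_seq (open_core A).
Proof.
by move=> m n mn; apply/subsetPset => x Ax y xy; apply: Ax; exact: agree_le xy.
Qed.

Lemma open_core_cup A : open A -> \bigcup_n open_core A n = A.
Proof.
move=> /open_agree oA; apply/seteqP; split=> [x [n _]|x /oA[n An]]; last by exists n.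
by apply.
Qed.

Lemma agree_translate n g x y :
  agree (n + site_norm g) x y -> agree n (translate g x) (translate g y).
Proof.
move=> xy s sn; rewrite /translate xy// (leq_ltn_trans (site_normD _ _))//.
by rewrite addnC ltn_add2r.
Qed.

Lemma measurable_translate g : measurable_fun setT (@translate R k d F F2 g).
Proof.
have : @measurable _ Sigma = <<s @open Sigma >> by [].
move=> mE; apply: (measurability (@open Sigma)) => //.
move=> _ [A oA <-]; rewrite setTI; apply: open_measurable_config.
apply/open_agree => x /= Ax; move/open_agree : oA => /(_ _ Ax)[n An].
by exists (n + site_norm g)%N => y /agree_translate/An.
Qed.

(* Every open set is the increasing union of the determined sets [open_core A n],
   so no enumeration of cylinders is needed. *)
Lemma config_prob_unique (P Q : probability Sigma R) :
  (forall n A, determined n A -> P A = Q A) ->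
  forall A, measurable A -> P A = Q A.
Proof.
move=> PQ A mA.
apply: (@measure_unique _ R Sigma (@open Sigma) (fun=> setT)) => //.
- by move=> B C oB oC; apply: openI.
- by move=> i; apply: openT.
- by rewrite bigcup_const//; exists 0%N.
- move=> B oB; rewrite -(open_core_cup oB).
  have h (S : probability Sigma R) :
      S (open_core B n) @[n --> \oo] --> S (\bigcup_n open_core B n).
    apply: nondecreasing_cvg_mu; last exact: open_core_homo.
      by move=> n; apply: determined_measurable; exact: open_core_determined.
    by apply: bigcup_measurable => n _; apply: determined_measurable; exact: open_core_determined.
  apply: cvg_unique (h P) _ => //.
  rewrite (_ : (fun n => _) = (fun n => Q (open_core B n))); first exact: h.
  by apply/funext => n; apply: PQ; exact: open_core_determined.
- by move=> i; rewrite (le_lt_trans (probability_le1 _ _))// ltry.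
Qed.

End Topology.

(** * Approximation of Borel sets by determined sets *)

Section Approximation.
Context {R : realType} {k : lattice_kind} {d : nat} {F : finType}.
Context {F2 : (1 < #|F|)%N}.
Local Notation Sigma := (config R k d F2).
Variable P : probability Sigma R.

Definition approximable (A : set Sigma) := measurable A /\
  forall e : R, 0 < e -> exists n C, determined n C /\
    (P ((A `\` C) `|` (C `\` A)) < e%:E)%E.

Lemma approximable_determined n A : determined n A -> approximable A.
Proof.
move=> dA; split=> [|e e0]; first exact: determined_measurable dA.
by exists n, A; split => //; rewrite setDv setUid measure0 lte_fin.
Qed.

Lemma approximableC A : approximable A -> approximable (~` A).
Proof.
move=> [mA hA]; split=> [|e /hA[n [C [dC PC]]]]; first exact: measurableC.
exists n, (~` C); split; first exact: determinedC.
rewrite !setDE !setCK setUC; move: PC; rewrite !setDE.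
by rewrite (setIC C) (setIC A).
Qed.

Lemma approximableU A B : approximable A -> approximable B -> approximable (A `|` B).
Proof.
move=> [mA hA] [mB hB]; split=> [|e e0]; first exact: measurableU.
have e2 : 0 < e / 2 by rewrite divr_gt0.
have [n [C [dC PC]]] := hA _ e2; have [m [D [dD PD]]] := hB _ e2.
exists (maxn n m), (C `|` D); split.
  by apply: determinedU; [apply: determined_le dC|apply: determined_le dD];
    rewrite ?leq_maxl ?leq_maxr.
have mC := determined_measurable dC; have mD := determined_measurable dD.
have mX : measurable ((A `\` C) `|` (C `\` A)).
  by apply: measurableU; exact: measurableD.
have mY : measurable ((B `\` D) `|` (D `\` B)).
  by apply: measurableU; exact: measurableD.
apply: (@le_lt_trans _ _ (P (((A `\` C) `|` (C `\` A)) `|` ((B `\` D) `|` (D `\` B))))).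
  apply: le_measure; rewrite ?inE//; [|exact: measurableU|].
    by apply: measurableU; apply: measurableD; exact: measurableU.
  move=> x [[[Ax|Bx] nCD]|[[Cx|Dx] nAB]].
  - by left; left; split => // Cx; apply: nCD; left.
  - by right; left; split => // Cx; apply: nCD; right.
  - by left; right; split => // Ax; apply: nAB; left.
  - by right; right; split => // Bx; apply: nAB; right.
apply: le_lt_trans (measureU2 _ mX mY) _.
by rewrite (splitr e) EFinD; apply: lteD.
Qed.

(** Continuity from below makes the part of the union outside some [B N] smaller than [e / 2]; the
    other half is spent on approximating [B N]. *)
Lemma approximable_limit (B : (set Sigma)^nat) : nondecreasing_seq B ->
  (forall n, approximable (B n)) -> approximable (\bigcup_n B n).
Proof.
move=> ndB hB; have mB n : measurable (B n) by have [] := hB n.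
have mA : measurable (\bigcup_n B n) by exact: bigcup_measurable.
split=> // e e0; have e2 : 0 < e / 2 by rewrite divr_gt0.
have [N PN] : exists N, (P ((\bigcup_n B n) `\` B N) < (e / 2)%:E)%E.
  have cB : P (B n) @[n --> \oo] --> P (\bigcup_n B n).
    exact: nondecreasing_cvg_mu.
  have fA : P (\bigcup_n B n) \is a fin_num by exact: fin_num_measure.
  have [N HN] : exists N, (P (\bigcup_n B n) - (e / 2)%:E < P (B N))%E.
    apply: contrapT => /forallNP H.
    have : (P (\bigcup_n B n) <= P (\bigcup_n B n) - (e / 2)%:E)%E.
      apply: cvge_to_le cB _; apply: nearW => n.
      by rewrite leNgt; apply/negP; exact: H.
    by rewrite leNgt lteBlDr// lteDl// lte_fin e2.
  exists N.
  rewrite measureD//; last by rewrite ltey_eq fA.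
  have -> : (\bigcup_n B n) `&` B N = B N.
    by rewrite setIidr//; apply: bigcup_sup.
  by rewrite lteBlDr ?fin_num_measure// addeC -lteBlDr.
have [n [C [dC PC]]] := (hB N).2 _ e2.
have mC := determined_measurable dC.
exists n, C; split => //.
apply: (@le_lt_trans _ _ (P (((\bigcup_n B n) `\` B N) `|` ((B N `\` C) `|` (C `\` B N))))).
  apply: le_measure; rewrite ?inE//.
  - by apply: measurableU; apply: measurableD.
  - by apply: measurableU; [|apply: measurableU]; apply: measurableD.
  move=> x [[Ax nC]|[Cx nA]].
    by have [Bx|nB] := pselect (B N x); [right; left|left].
  by right; right; split => // BNx; apply: nA; exists N.
have mX : measurable ((\bigcup_n B n) `\` B N) by exact: measurableD.
have mY : measurable ((B N `\` C) `|` (C `\` B N)).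
  by apply: measurableU; exact: measurableD.
apply: le_lt_trans (measureU2 _ mX mY) _.
by rewrite (splitr e) EFinD; apply: lteD.
Qed.

(** The approximable sets form a sigma-algebra that contains the open sets, since an open set is an
    increasing union of determined ones. *)
Lemma measurable_approximable A : measurable A -> approximable A.
Proof.
move=> mA; suff : <<s @open Sigma >> `<=` approximable by apply.
apply: smallest_sub; last first.
  move=> U oU; rewrite -(open_core_cup oU); apply: approximable_limit.
    exact: open_core_homo.
  by move=> n; apply: approximable_determined; exact: open_core_determined.
split.
- by apply: (@approximable_determined 0).
- by move=> B hB; rewrite setTD; exact: approximableC.
move=> B hB.
(* A countable union is turned into the increasing union of its finite partial unions. *)
rewrite -bigcup_bigsetU_bigcup.
apply: approximable_limit.
  by move=> m n mn; apply/subsetPset; apply: subset_bigsetU.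
move=> n; elim: n.+1 => {n}[|n IH].
  by rewrite big_ord0; apply: (@approximable_determined 0).
by rewrite big_ord_recr/=; exact: approximableU.
Qed.

End Approximation.

(** * Words on boxes and subadditivity of their entropy *)

Section Boxes.
Context {R : realType} {k : lattice_kind} {d : nat} {F : finType}.
Context {F2 : (1 < #|F|)%N}.
Local Notation Sigma := (config R k d F2).
Implicit Types (x y : Sigma) (g s t : site k d).

Definition box_word n x : {ffun {ffun 'I_d -> 'I_n} -> F} :=
  [ffun v => x (box_site k v)].

Lemma box_wordE n g x v : box_word n (translate g x) v = x (g + box_site k v).
Proof. by rewrite ffunE. Qed.

Lemma agree_box_word n m x y : agree n.+1 x y -> (m <= n)%N -> box_word m x = box_word m y.
Proof.
move=> xy mn; apply/ffunP => v; rewrite !ffunE xy// ltnS (leq_trans (box_site_norm v))//.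
Qed.

Lemma determined_box_word n (A : set {ffun {ffun 'I_d -> 'I_n} -> F}) :
  determined n.+1 (box_word n @^-1` A).
Proof. by move=> x y /agree_box_word /(_ (leqnn n)) xy /=; rewrite xy. Qed.

Lemma finite_valued_translate (T : finType) (f : Sigma -> T) g : finite_valued f ->
  finite_valued (f \o translate g).
Proof.
move=> mf t; rewrite (_ : _ @^-1` _ = translate g @^-1` (f @^-1` [set t]))//.
by rewrite -[X in measurable X]setTI; apply: measurable_translate.
Qed.

Lemma finite_valued_box_word n : finite_valued (@box_word n).
Proof.
by move=> w; apply: (@determined_measurable R k d F F2 n.+1);
  exact: determined_box_word.
Qed.

Lemma determined_box n (A : set Sigma) : determined n A ->
  exists (t : site k d) m (S : pred {ffun {ffun 'I_d -> 'I_m} -> F}),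
    A = translate t @^-1` (box_word m @^-1` [set w | S w]).
Proof.
move=> dA; have [t [m tm]] := @site_ball_box k d n.
exists t, m, (fun w => `[< exists2 x, A x & box_word m (translate t x) = w >]).
apply/seteqP; split=> x /=; first by move=> Ax; apply/asboolP; exists x.
move=> /asboolP[y Ay xy]; apply: dA Ay => s /tm[v ->].
by rewrite -!box_wordE xy.
Qed.

Variable nu : invariant_measure R k d F2.

Lemma law_translate (T : finType) (f : Sigma -> T) g : finite_valued f ->
  law nu (f \o translate g) = law nu f.
Proof.
move=> mf; apply/funext => t; rewrite /law; congr fine.
exact: (invariant_probabilityP nu g (mf t)).
Qed.

Lemma rv_entropy_translate (T : finType) (f : Sigma -> T) g : finite_valued f ->
  rv_entropy nu (f \o translate g) = rv_entropy nu f.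
Proof. by move=> mf; rewrite /rv_entropy law_translate. Qed.

(** [K ^ d] translates of the box of side [M] cover the box of side [n]; their words have equal
    entropy by invariance, and entropy is subadditive. *)
Lemma rv_entropy_box_cover n M K : (0 < M)%N -> (n <= K * M)%N ->
  rv_entropy nu (@box_word n) <= K%:R ^+ d * rv_entropy nu (@box_word M).
Proof.
move=> M0 nKM.
have qP (v : 'I_n) : (v %/ M < K)%N.
  by rewrite ltn_divLR// (leq_trans (ltn_ord v)).
have rP (v : 'I_n) : (v %% M < M)%N by rewrite ltn_pmod.
have cP (u : 'I_K) : (M * u < (M * K).+1)%N by rewrite ltnS leq_mul2l ltnW ?orbT.
pose q (v : {ffun 'I_d -> 'I_n}) : {ffun 'I_d -> 'I_K} := [ffun i => Ordinal (qP (v i))].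
pose r (v : {ffun 'I_d -> 'I_n}) : {ffun 'I_d -> 'I_M} := [ffun i => Ordinal (rP (v i))].
(* The corner of the block [u]; its ordinal type serves to present it as a box site. *)
pose c (u : {ffun 'I_d -> 'I_K}) : {ffun 'I_d -> 'I_(M * K).+1} :=
  [ffun i => Ordinal (cP (u i))].
pose f (u : {ffun 'I_d -> 'I_K}) := @box_word M \o translate (box_site k (c u)).
have mf u : finite_valued (f u).
  by apply: finite_valued_translate; exact: finite_valued_box_word.
pose h (w : {ffun {ffun 'I_d -> 'I_K} -> {ffun {ffun 'I_d -> 'I_M} -> F}}) :
  {ffun {ffun 'I_d -> 'I_n} -> F} := [ffun v => w (q v) (r v)].
have -> : @box_word n = h \o (fun x => [ffun u => f u x]).
  apply/funext => x; apply/ffunP => v; rewrite /= !ffunE /translate; congr x.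
  apply/esym/box_siteD => i; by rewrite !ffunE/= mulnC -divn_eq.
apply: le_trans (rv_entropy_comp_le nu _ (finite_valued_ffun mf)) _.
apply: le_trans (rv_entropy_ffun_le nu mf) _.
rewrite (eq_bigr (fun=> rv_entropy nu (@box_word M))); last first.
  by move=> u _; rewrite rv_entropy_translate//; exact: finite_valued_box_word.
by rewrite sumr_const card_ffun !card_ord -natrX mulr_natl.
Qed.

Lemma rv_entropy_ge0 (T : finType) (f : Sigma -> T) : finite_valued f -> 0 <= rv_entropy nu f.
Proof.
move=> mf; apply: sumr_ge0 => t _; rewrite oppr_ge0 mulr_ge0_le0 ?law_ge0//.
by apply: ln_le0; apply: fine_prob_le1.
Qed.

(** Its fibres are the atoms of the join of partitions that [box_entropy] measures. *)
Definition joint (T : finType) (al : Sigma -> T) n x : {ffun {ffun 'I_d -> 'I_n} -> T} :=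
  [ffun v => al (translate (box_site k v) x)].

Lemma finite_valued_joint (T : finType) (al : Sigma -> T) n : finite_valued al ->
  finite_valued (joint al n).
Proof. by move=> mal; apply: finite_valued_ffun => v; exact: finite_valued_translate. Qed.

(** A window of side [m] that slides over a box of side [n] stays inside a box of side [n + m], so
    the joint variable is a function of one larger word. *)
Lemma rv_entropy_joint_box (T : finType) m (h : {ffun {ffun 'I_d -> 'I_m} -> F} -> T) t n :
  rv_entropy nu (joint (fun x => h (box_word m (translate t x))) n) <=
  rv_entropy nu (@box_word (n + m)).
Proof.
rewrite -(rv_entropy_translate t (@finite_valued_box_word (n + m))).
have P (u : 'I_n) (v : 'I_m) : (u + v < n + m)%N.
  by rewrite -addSn leq_add// ltnW.
pose s (u : {ffun 'I_d -> 'I_n}) (v : {ffun 'I_d -> 'I_m}) : {ffun 'I_d -> 'I_(n + m)} :=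
  [ffun i => Ordinal (P (u i) (v i))].
pose g (w : {ffun {ffun 'I_d -> 'I_(n + m)} -> F}) : {ffun {ffun 'I_d -> 'I_n} -> T} :=
  [ffun u => h [ffun v => w (s u v)]].
have -> : joint (fun x => h (box_word m (translate t x))) n =
    g \o (@box_word (n + m) \o translate t).
  apply/funext => x; apply/ffunP => u; rewrite !ffunE; congr h.
  apply/ffunP => v; rewrite [RHS]ffunE box_wordE box_wordE /translate; congr x.
  rewrite addrCA; congr (_ + _).
  by apply: box_siteD => i; rewrite ffunE.
apply: rv_entropy_comp_le; apply: finite_valued_translate; exact: finite_valued_box_word.
Qed.

(* [al] is recovered from [al'] and the error variable, which is [None] where the
   two agree. *)
Lemma rv_entropy_joint_le (T : finType) (al al' : Sigma -> T) n :
  finite_valued al -> finite_valued al' ->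
  rv_entropy nu (joint al n) <= rv_entropy nu (joint al' n) +
    n%:R ^+ d * rv_entropy nu (fun x => if al x == al' x then None else Some (al x)).
Proof.
move=> mal mal'; set D := fun x => _.
have mD : finite_valued D.
  rewrite (_ : D = (fun p : T * T => if p.1 == p.2 then None else Some p.1) \o
    (fun x => (al x, al' x)))//.
  by apply: finite_valued_comp; exact: finite_valued_pair.
pose h (p : {ffun {ffun 'I_d -> 'I_n} -> T} * {ffun {ffun 'I_d -> 'I_n} -> option T}) :
  {ffun {ffun 'I_d -> 'I_n} -> T} := [ffun v => odflt (p.1 v) (p.2 v)].
have -> : joint al n = h \o (fun x => (joint al' n x, joint D n x)).
  apply/funext => x; apply/ffunP => v; rewrite /= !ffunE /= ?ffunE /D.
  by case: eqP.
have mj := finite_valued_joint (n := n) mal'; have mjD := finite_valued_joint (n := n) mD.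
apply: le_trans (rv_entropy_comp_le nu _ (finite_valued_pair mj mjD)) _.
apply: le_trans (rv_entropy_pair_le nu mj mjD) _; rewrite lerD2l.
have mDt (v : {ffun 'I_d -> 'I_n}) : finite_valued (D \o translate (box_site k v)).
  exact: finite_valued_translate.
apply: le_trans (rv_entropy_ffun_le nu mDt) _.
rewrite (eq_bigr (fun=> rv_entropy nu D)); last first.
  by move=> u _; rewrite rv_entropy_translate.
by rewrite sumr_const card_ffun !card_ord -natrX mulr_natl.
Qed.

End Boxes.

(** * Kolmogorov-Sinai bound *)

Section Limits.
Context {R : realType}.

Lemma cvg_const_over_nat (a : R) : a / n%:R @[n --> \oo] --> 0.
Proof.
rewrite -[0](mulr0 a); apply: cvgMl_tmp => //.
apply/(gtr0_cvgV0 (f := fun n => n%:R : R)); last exact: cvgr_idn.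
by near=> n; rewrite ltr0n; near: n; exact: nbhs_infty_gt.
Unshelve. all: by end_near. Qed.

(** [((n + c) %/ M).+1] blocks of side [M] cover a segment of length [n + c]; divided by [n], their
    number exceeds [1 / M] by at most a constant over [n]. *)
Lemma cvg_block_count (d c M : nat) : (0 < M)%N ->
  ((((n + c) %/ M).+1%:R / n%:R) ^+ d : R) @[n --> \oo] --> ((M%:R^-1) ^+ d : R).
Proof.
move=> M0; apply: (@cvg_comp _ _ _ (fun n => ((n + c) %/ M).+1%:R / n%:R : R)
  (fun x : R => x ^+ d) _ (nbhs (M%:R^-1 : R))); last exact: exprn_continuous.
have M0R : 0 < M%:R :> R by rewrite ltr0n.
apply: (@squeeze_cvgr _ _ _ _ (fun=> M%:R^-1)
   (fun n => M%:R^-1 + (M%:R^-1 * (c + M)%:R) / n%:R)); last 2 first.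
- exact: cvg_cst.
- rewrite -[X in _ --> X]addr0; apply: cvgD; first exact: cvg_cst.
  exact: cvg_const_over_nat.
near=> n; have n0 : 0 < n%:R :> R.
  by rewrite ltr0n; near: n; exact: nbhs_infty_gt.
apply/andP; split.
  rewrite ler_pdivlMr// ler_pdivrMl// -natrM ler_nat mulnC.
  apply: leq_trans (ltnW (ltn_ceil (n + c) M0)); exact: leq_addr.
rewrite -mulrA -{1}[M%:R^-1]mulr1 -mulrDr ler_pdivrMr// -mulrA ler_pdivlMl//.
rewrite mulrDl mul1r divfK ?gt_eqF// -natrM -natrD ler_nat mulnS.
by rewrite addnA [leqRHS]addnC leq_add2l mulnC leq_divM.
Unshelve. all: by end_near. Qed.

(* The limit is the infimum of [H M / M^d], as in Fekete's lemma. *)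
Lemma cvg_subadditive (d : nat) (H : nat -> R) :
  (forall n, 0 <= H n) ->
  (forall n M K, (0 < M)%N -> (n <= K * M)%N -> H n <= K%:R ^+ d * H M) ->
  cvgn (fun n => H n / n%:R ^+ d).
Proof.
move=> H0 HK; set E := [set H M / M%:R ^+ d | M in [set M | (0 < M)%N]].
have hE : has_inf E.
  split; first by exists (H 1%N / 1%:R ^+ d), 1%N.
  by exists 0 => _ [M _ <-]; rewrite divr_ge0.
apply/cvg_ex; exists (inf E); apply/cvgrPdist_le => e e0.
have e2 : 0 < e / 2 by rewrite divr_gt0.
have [_ [M M0 <-] HM] := inf_adherent e2 hE.
have hc : ((((n + 0) %/ M).+1%:R / n%:R) ^+ d * H M : R) @[n --> \oo] -->
    ((M%:R^-1) ^+ d * H M : R).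
  by apply: cvgMr_tmp; exact: cvg_block_count.
move/cvgrPdist_le : hc => /(_ _ e2) hc.
near=> n; have n0 : (0 < n)%N by near: n; exact: nbhs_infty_gt.
have lE : inf E <= H n / n%:R ^+ d by apply: ge_inf; [case: hE|exists n].
rewrite distrC ger0_norm ?subr_ge0// lerBlDl.
have le1 : H n / n%:R ^+ d <= (((n + 0) %/ M).+1%:R / n%:R) ^+ d * H M.
  rewrite addn0 expr_div_n mulrAC ler_pM2r ?invr_gt0 ?exprn_gt0 ?ltr0n//.
  by apply: HK => //; exact: ltnW (ltn_ceil _ _).
apply: le_trans le1 _.
have : `|M%:R^-1 ^+ d * H M - (((n + 0) %/ M).+1%:R / n%:R) ^+ d * H M| <= e / 2.
  by near: n.
rewrite ler_norml => /andP[+ _].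
move: HM; rewrite exprVn mulrC; lra.
Unshelve. all: by end_near. Qed.

End Limits.

Section KolmogorovSinai.
Context {R : realType} {k : lattice_kind} {d : nat} {F : finType}.
Context {F2 : (1 < #|F|)%N}.
Local Notation Sigma := (config R k d F2).
Variable nu : invariant_measure R k d F2.

Lemma box_entropyE m (al : Sigma -> 'I_m) n :
  box_entropy nu (fun i => al @^-1` [set i]) n = rv_entropy nu (joint al n).
Proof.
apply: eq_bigr => w _ /=; rewrite /law.
rewrite (_ : joint al n @^-1` [set w] =
  \bigcap_v (translate (box_site k v) @^-1` (al @^-1` [set w v])))//.
apply/seteqP; split => x /=; first by move=> <- v _ /=; rewrite ffunE.
by move=> H; apply/ffunP => v; rewrite ffunE H.
Qed.

Lemma partition_class m (A : 'I_m -> set Sigma) :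
  partition [set: 'I_m] A [set: Sigma] ->
  exists al : Sigma -> 'I_m, A = fun i => al @^-1` [set i].
Proof.
move=> [cA tA _].
have h x : exists i, A i x.
  by have : setT x by []; rewrite -cA => -[i _ Ai]; exists i.
have [al hal] := choice h; exists al; apply/funext => i; apply/seteqP.
split=> x /=; last by move=> <-.
by move=> Ai; apply: tA => //; exists x.
Qed.

(** The value at a word is read off from any configuration that shows it: [f] does not separate two
    such configurations. *)
Lemma local_factor (T : finType) (f : Sigma -> T) n :
  (forall x y, agree n x y -> f x = f y) ->
  exists (t : site k d) m (h : {ffun {ffun 'I_d -> 'I_m} -> F} -> T),
    f = fun x => h (box_word m (translate t x)).
Proof.
move=> fn; have [t [m tm]] := @site_ball_box k d n.
exists t, m, (fun w => f (get [set x | box_word m (translate t x) = w])).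
apply/funext => x; apply: fn => s /tm[v ->].
rewrite -!box_wordE; congr (_ v).
by apply/esym; rewrite (@getPex _ [set y | box_word m (translate t y) = _])//; exists x.
Qed.

(** Each fibre of [al] is approximated within [e / m] by a determined set, and the new labels are
    read from these sets. *)
Lemma approximable_class m (al : Sigma -> 'I_m) (e : R) : 0 < e -> finite_valued al ->
  exists n (al' : Sigma -> 'I_m), (forall x y, agree n x y -> al' x = al' y) /\
    fine (nu [set x | al x != al' x]) < e.
Proof.
move=> e0 mal; set i0 := al point.
have m0 : 0 < m%:R :> R by rewrite ltr0n (leq_ltn_trans _ (ltn_ord i0)).
have hC i : exists nC : nat * set Sigma, determined nC.1 nC.2 /\
    (nu ((al @^-1` [set i] `\` nC.2) `|` (nC.2 `\` al @^-1` [set i])) < (e / m%:R)%:E)%E.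
  have [_ /(_ _ (divr_gt0 e0 m0)) [n [C [dC PC]]]] := measurable_approximable nu (mal i).
  by exists (n, C).
have [C {}hC] := choice hC.
(* The sets [(C i).2] may overlap or miss points: [pick] settles the overlaps and [i0] is the label
   where none applies. *)
set n := \max_i (C i).1; set al' := fun x => odflt i0 [pick i | `[< (C i).2 x >]].
have hagree x y : agree n x y -> al' x = al' y.
  move=> xy; rewrite /al'; congr (odflt _ _); apply: eq_pick => i.
  have {}xy : agree (C i).1 x y by apply: agree_le xy; exact: leq_bigmax.
  apply/asboolP/asboolP; apply: (hC i).1 => //; exact: agree_sym.
exists n, al'; split => //.
pose B i := (al @^-1` [set i] `\` (C i).2) `|` ((C i).2 `\` al @^-1` [set i]).
have mB i : measurable (B i).
  have mC := determined_measurable (hC i).1.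
  by apply: measurableU; apply: measurableD => //; exact: mal.
have mD : measurable [set x | al x != al' x].
  have mal' : finite_valued al'.
    by move=> i; apply: (@determined_measurable _ _ _ _ _ n) => x y /hagree + /= <-.
  exact: (finite_valued_set (fun p : 'I_m * 'I_m => p.1 != p.2) (finite_valued_pair mal mal')).
have DB : [set x | al x != al' x] `<=` \bigcup_(i in [set` enum 'I_m]) B i.
  (* Off all the error sets, [x] lies in [(C i).2] exactly for [i = al x], so [pick] returns the
     right label. *)
  move=> x /= xx; have [j Bj] : exists j, B j x; last by exists j => //=; rewrite mem_enum.
  apply: contrapT => nB.
  have eqC i : (C i).2 x <-> al x = i.
    split=> H; apply: contrapT => H'; apply: nB; exists i; [by right|by left].
  move: xx; rewrite /al'; case: pickP => [i /asboolP/eqC ->|/(_ (al x))].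
    by rewrite eqxx.
  by move/asboolP; rewrite eqC.
apply: le_lt_trans (_ : \sum_(i < m) fine (nu (B i)) < _); last first.
  have -> : e = \sum_(i < m) (e / m%:R).
    by rewrite sumr_const card_ord -[RHS]mulr_natr divfK// gt_eqF.
  apply: ltr_sum; last by move=> i _; rewrite -lte_fin fine_prob//; exact: (hC i).2.
  by apply/hasP; exists i0; rewrite ?mem_index_enum.
apply: le_trans (fine_prob_bigsetU_le nu (index_enum 'I_m) mB).
apply: le_fine_prob => //; first exact: bigsetU_measurable.
by move=> x /DB; rewrite bigcup_seq big_enum.
Qed.

(** Up to an error variable of entropy at most [e], the labels are local, hence functions of a box
    word of side [n + m']; that box is covered by blocks of side [M]. Let [n] grow, then [e]
    shrink. *)
Lemma partition_entropy_le m (A : 'I_m -> set Sigma) M :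
  (forall i, measurable (A i)) -> partition [set: 'I_m] A [set: Sigma] ->
  (0 < M)%N -> partition_entropy nu A <= rv_entropy nu (@box_word R k d F F2 M) / M%:R ^+ d.
Proof.
move=> mA /partition_class[al Aal] M0; rewrite {}Aal in mA *.
have mal : finite_valued al by [].
have HM0 := rv_entropy_ge0 nu (@finite_valued_box_word R k d F F2 M).
apply/ler_addgt0Pl => e e0; rewrite /partition_entropy addrC.
have [cvgE|/dvgP ->] := pselect (cvgn (fun n =>
  box_entropy nu (fun i => al @^-1` [set i]) n / n%:R ^+ d)); last first.
  (* [lim] of a divergent sequence is the default point 0. *)
  by rewrite addr_ge0 ?divr_ge0// ltW.
(* The error variable [D] below takes the value [None] with probability at least [1 - del]. *)
have [del del0 hdel] := shannon_small (option 'I_m) e0.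
have [N [al' [al'N alal']]] := approximable_class del0 mal.
have mal' : finite_valued al'.
  by move=> i; apply: (@determined_measurable _ _ _ _ _ N) => x y /al'N + /= <-.
set D := fun x => if al x == al' x then None else Some (al x).
pose Dp (p : 'I_m * 'I_m) := if p.1 == p.2 then None else Some p.1.
have mD : finite_valued D.
  exact: (finite_valued_comp Dp (finite_valued_pair mal mal')).
have HD : rv_entropy nu D <= e.
  apply: (hdel _ None); [exact: law_ge0|exact: law_sum|].
  rewrite -(law_sum nu mD) (bigD1 None)//= addrAC subrr add0r -prob_law//.
  apply: le_trans (ltW alal'); rewrite le_eqVlt; apply/orP; left; apply/eqP.
  congr (fine (nu _)); apply/seteqP; split=> x; rewrite /= /D.
   by case: ifPn.
  by case: ifPn => // /eqP ->.
have [t [m' [h al'h]]] := local_factor al'N.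
have bnd n : (0 < n)%N -> box_entropy nu (fun i => al @^-1` [set i]) n / n%:R ^+ d <=
    (((n + m') %/ M).+1%:R / n%:R) ^+ d * rv_entropy nu (@box_word R k d F F2 M) + e.
  move=> n0; have n0R : 0 < n%:R ^+ d :> R by rewrite exprn_gt0// ltr0n.
  rewrite ler_pdivrMr// mulrDl expr_div_n mulrAC divfK ?gt_eqF// box_entropyE.
  apply: le_trans (rv_entropy_joint_le nu n mal mal') _; apply: lerD; last first.
    by rewrite mulrC ler_wpM2r// ltW.
  rewrite al'h; apply: le_trans (rv_entropy_joint_box _ _ _ _) _.
  by apply: rv_entropy_box_cover => //; exact: ltnW (ltn_ceil _ _).
have cv : ((((n + m') %/ M).+1%:R / n%:R) ^+ d * rv_entropy nu (@box_word R k d F F2 M) + e)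
    @[n --> \oo] --> (M%:R^-1 ^+ d * rv_entropy nu (@box_word R k d F F2 M) + e : R).
  by apply: cvgD; [apply: cvgMr_tmp; exact: cvg_block_count|exact: cvg_cst].
rewrite [X in X + _]mulrC -exprVn; apply: ler_cvg_to cvgE cv _.
near=> n; apply: bnd; near: n; exact: nbhs_infty_gt.
Unshelve. all: by end_near. Qed.

Lemma entropy_le M : (0 < M)%N ->
  (entropy nu <= (rv_entropy nu (@box_word R k d F F2 M) / M%:R ^+ d)%:E)%E.
Proof.
move=> M0; apply: ge_ereal_sup => _ [m [A [mA pA ->]]].
by rewrite lee_fin; exact: partition_entropy_le.
Qed.

(** The partition by the symbol at the origin generates: its joint variable over a box is the box
    word with the symbols renamed. *)
Lemma entropy_ge (u : nat -> R) (b : R) :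
  (forall n, u n <= rv_entropy nu (@box_word R k d F F2 n) / n%:R ^+ d) ->
  u n @[n --> \oo] --> b -> (b%:E <= entropy nu)%E.
Proof.
move=> uH ub; pose al (x : Sigma) : 'I_#|F| := enum_rank (x 0).
have mal : finite_valued al.
  move=> i; apply: (@determined_measurable _ _ _ _ _ 1) => x y xy.
  rewrite /= /al xy// ltnS leqn0; apply/eqP/eqP; rewrite -leqn0.
  by apply/bigmax_leqP => j _; rewrite ffunE; case: (k).
have boxE n : box_entropy nu (fun i => al @^-1` [set i]) n = rv_entropy nu (@box_word R k d F F2 n).
  pose g (w : {ffun {ffun 'I_d -> 'I_n} -> F}) : {ffun {ffun 'I_d -> 'I_n} -> 'I_#|F|} :=
    [ffun v => enum_rank (w v)].
  pose h (w : {ffun {ffun 'I_d -> 'I_n} -> 'I_#|F|}) : {ffun {ffun 'I_d -> 'I_n} -> F} :=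
    [ffun v => enum_val (w v)].
  have E1 : joint al n = g \o @box_word R k d F F2 n.
    by apply/funext => x; apply/ffunP => v; rewrite !ffunE /al /translate addr0.
  have E2 : @box_word R k d F F2 n = h \o joint al n.
    apply/funext => x; apply/ffunP => v.
    by rewrite !ffunE /al /translate addr0 enum_rankK.
  rewrite box_entropyE; apply/eqP; rewrite eq_le; apply/andP; split.
    by rewrite E1; apply: rv_entropy_comp_le; exact: finite_valued_box_word.
  by rewrite [in leLHS]E2; apply: rv_entropy_comp_le; exact: finite_valued_joint.
apply: (@le_trans _ _ (partition_entropy nu (fun i => al @^-1` [set i]))%:E).
  rewrite lee_fin /partition_entropy.
  under eq_fun do rewrite boxE.
  (* Convergence must be known before [lim] can be compared with [b], since a divergent sequence
     would get a default value. *)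
  have cH : cvgn (fun n => rv_entropy nu (@box_word R k d F F2 n) / n%:R ^+ d).
    apply: cvg_subadditive => [n|n M K M0 nKM].
      exact: rv_entropy_ge0 (@finite_valued_box_word _ _ _ _ _ _).
    exact: rv_entropy_box_cover.
  by apply: ler_cvg_to ub cH _; apply: nearW.
apply: ereal_sup_ubound; exists #|F|, (fun i => al @^-1` [set i]); split => //.
split.
- by apply/seteqP; split => // x _; exists (al x).
- by move=> i j _ _ [x [/= <- <-]].
- by move=> i _; exists (fun=> enum_val i); rewrite /= /al enum_valK.
Qed.

End KolmogorovSinai.

(** * Counting functions on finite types *)

Lemma card_family_prod (J T : finType) (G : J -> pred T) :
  #|[set f : {ffun J -> T} | [forall j, G j (f j)]]%SET| = (\prod_j #|G j|)%N.
Proof.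
rewrite cardsE -[RHS]big_enum/= -(big_map (fun j => #|G j|) xpredT id) -foldrE.
by rewrite -(card_family G); apply: eq_card => f; rewrite !inE.
Qed.

(** The values off the image of [e] are free. Multiplying by [#|T| ^ #|I|] avoids a subtraction in
    the exponent. *)
Lemma card_ffun_extension (I J : finType) (T : finType) (e : I -> J) (w : {ffun I -> T}) :
  injective e ->
  (#|[set f : {ffun J -> T} | [ffun i => f (e i)] == w]%SET| * #|T| ^ #|I| = #|T| ^ #|J|)%N.
Proof.
move=> ie; pose G j : pred T := fun y => [forall i, (e i == j) ==> (w i == y)].
rewrite (_ : finset _ = [set f : {ffun J -> T} | [forall j, G j (f j)]]%SET); last first.
  apply/setP => f; rewrite !inE; apply/eqP/forallP => [fw j|H].
    by apply/forallP => i; apply/implyP => /eqP <-; rewrite -fw ffunE.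
  apply/ffunP => i; rewrite ffunE; have /forallP/(_ i) := H (e i).
  by rewrite eqxx => /eqP ->.
rewrite card_family_prod (bigID (mem (codom e)))/= big1 ?mul1n; last first.
  move=> _ /codomP[i ->]; rewrite (eq_card (B := pred1 (w i))) ?card1// => y.
  rewrite !inE /G; apply/forallP/eqP => [/(_ i)|-> j].
    by rewrite eqxx => /eqP.
  by apply/implyP => /eqP/ie ->.
rewrite (eq_bigr (fun=> #|T|)); last first.
  move=> j jI; apply: eq_card => y; rewrite !inE /G; apply/forallP => i.
  by apply/implyP => /eqP ij; rewrite -ij codom_f in jI.
rewrite prod_nat_const -expnD -(card_codom ie) addnC.
by rewrite -(cardC (mem (codom e))).
Qed.

(** * Random sparse configurations *)

Section UniformBits.
Context {R : realType}.

(** The binary digit of weight [2 ^- n.+1]; the digits of a uniform point of the unit interval serve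
    as independent fair coins. *)
Definition bit (n : nat) (t : R) : bool := odd (Num.truncn (2 ^+ n.+1 * t)).

(** The integer with binary digits [w 0], ..., [w (n - 1)], the most significant first. *)
Fixpoint dyadic (w : nat -> bool) (n : nat) : nat :=
  if n is m.+1 then ((dyadic w m).*2 + w m)%N else 0%N.

Lemma dyadic_lt w n : (dyadic w n < 2 ^ n)%N.
Proof. by elim: n => //= n; rewrite expnS mul2n; case: (w n) => /=; lia. Qed.

Lemma truncn_half (x : R) m (b : bool) : 0 <= x ->
  Num.truncn (2 * x) = (m.*2 + b)%N -> Num.truncn x = m.
Proof.
move=> x0 /eqP; rewrite Num.Theory.truncn_eq ?mulr_ge0// => /andP[lo hi].
apply: Num.Theory.truncn_def; apply/andP; split.
  rewrite -(ler_pM2l (ltr0n R 2)) -natrM mul2n (le_trans _ lo)// ler_nat leq_addr//.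
rewrite -(ltr_pM2l (ltr0n R 2)) -natrM mul2n (lt_le_trans hi)// ler_nat.
by case: (b); lia.
Qed.

Lemma bit_dyadic w n (t : R) : 0 <= t -> Num.truncn (2 ^+ n * t) = dyadic w n ->
  forall i, (i < n)%N -> bit i t = w i.
Proof.
move=> t0; elim: n => // n IH /= H i; rewrite ltnS leq_eqVlt => /predU1P[->|].
  by rewrite /bit H oddD odd_double; case: (w n).
apply: IH; apply: (truncn_half (b := w n)); first by rewrite mulr_ge0 ?exprn_ge0.
by rewrite mulrA -exprS.
Qed.

Let P : probability _ R := uniform_prob (@ltr01 R).

Lemma uniform_prob_itv (a b : R) : 0 <= a -> a < b -> b <= 1 ->
  P `[a, b[%classic = (b - a)%:E.
Proof.
move=> a0 ab b1; rewrite /P /= /uniform_prob integral_uniform_pdf.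
rewrite setIidl; last first.
  move=> x /=; rewrite !in_itv/= => /andP[ax xb].
  by rewrite (le_trans a0 ax) (le_trans (ltW xb) b1).
rewrite (eq_integral (fun=> 1%:E)); last first.
  move=> x; rewrite inE/= in_itv/= => /andP[ax xb].
  by rewrite /uniform_pdf (le_trans a0 ax) (le_trans (ltW xb) b1) subr0 invr1.
by rewrite integral_cst//= mul1e lebesgue_measure_itv/= lte_fin ab.
Qed.

Lemma measurable_bit n : finite_valued (bit n).
Proof.
have c0 : 0 < 2 ^+ n.+1 :> R by rewrite exprn_gt0.
have mle j : measurable [set t : R | (Num.truncn (2 ^+ n.+1 * t) <= j)%N].
  rewrite (_ : [set t | _] = `]-oo, (j.+1%:R / 2 ^+ n.+1)[%classic).
    exact: measurable_itv.
  apply/seteqP; split => t /=; rewrite in_itv/= Num.Theory.truncn_le_nat.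
    by rewrite ltr_pdivlMr// mulrC.
  by rewrite ltr_pdivlMr// mulrC.
have meq j : measurable [set t : R | Num.truncn (2 ^+ n.+1 * t) = j].
  case: j => [|j].
    rewrite (_ : [set t | _] = [set t : R | (Num.truncn (2 ^+ n.+1 * t) <= 0)%N])//.
    by apply/seteqP; split => t /=; rewrite leqn0 => /eqP.
  rewrite (_ : [set t | _] = [set t : R | (Num.truncn (2 ^+ n.+1 * t) <= j.+1)%N] `\`
    [set t : R | (Num.truncn (2 ^+ n.+1 * t) <= j)%N]); first exact: measurableD.
  by apply/seteqP; split => t /=; [move=> ->; split => //; lia|case; lia].
move=> b; rewrite (_ : _ @^-1` _ = \bigcup_(j in [set j | odd j = b])
  [set t : R | Num.truncn (2 ^+ n.+1 * t) = j]).
  by apply: bigcup_measurable.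
apply/seteqP; split => t /=; first by move=> bt; exists (Num.truncn (2 ^+ n.+1 * t)).
by move=> [j /= <- jt]; rewrite /bit jt.
Qed.

(* The word [w] occurs on a dyadic interval of length [2^-n]; as these lower bounds
   add up to 1, they are equalities. *)
Lemma law_bits n (w : {ffun 'I_n -> bool}) :
  law P (fun t => [ffun i : 'I_n => bit i t]) w = 2 ^- n.
Proof.
set f := fun t => _.
have mf : finite_valued f by apply: finite_valued_ffun => i; exact: measurable_bit.
have lb v : 2 ^- n <= law P f v.
  pose w' i := if insub i is Some j then v j else false.
  have n0 : 0 < 2 ^+ n :> R by rewrite exprn_gt0.
  pose a : R := (dyadic w' n)%:R / 2 ^+ n.
  have a0 : 0 <= a by rewrite divr_ge0// ltW.
  have ab : a < a + 2 ^- n by rewrite ltrDl invr_gt0.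
  have b1 : a + 2 ^- n <= 1.
    rewrite /a -[X in _ + X]mul1r -mulrDl ler_pdivrMr// mul1r natr1 -natrX ler_nat.
    by rewrite dyadic_lt.
  rewrite -lee_fin fine_prob// -[X in X%:E](addKr a) addrC -(uniform_prob_itv a0 ab b1).
  apply: le_measure; rewrite ?inE//.
  move=> t /=; rewrite in_itv/= => /andP[at_ tb]; apply/ffunP => i; rewrite ffunE.
  rewrite (@bit_dyadic w' n) ?(le_trans a0)//; first by rewrite /w' valK.
  apply: Num.Theory.truncn_def; move: at_ tb.
  by rewrite /a -[X in _ + X]mul1r -mulrDl ltr_pdivlMr// ler_pdivrMr// natr1 mulrC => -> ->.
apply/eqP; rewrite eq_le lb andbT leNgt; apply/negP => H.
have : \sum_(v : {ffun 'I_n -> bool}) 2 ^- n < \sum_v law P f v.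
  by rewrite (bigD1 w)//= [ltRHS](bigD1 w)//= ltr_leD//; apply: ler_sum.
rewrite law_sum// sumr_const card_ffun card_bool card_ord -[X in X < _]mulr_natr natrX.
by rewrite mulVf ?ltxx// gt_eqF// exprn_gt0.
Qed.

(** The word of the first [n] digits is uniform, and every word on the chosen positions has the same
    number of extensions to it. *)
Lemma law_bits_inj (I : finType) (e : I -> nat) (w : {ffun I -> bool}) : injective e ->
  law P (fun t => [ffun i => bit (e i) t]) w = 2 ^- #|I|.
Proof.
move=> ie; pose n := (\max_i e i).+1.
have en i : (e i < n)%N by rewrite ltnS leq_bigmax.
pose e' i := Ordinal (en i).
have ie' : injective e' by move=> i j [] /ie.
pose r (f : {ffun 'I_n -> bool}) : {ffun I -> bool} := [ffun i => f (e' i)].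
rewrite (_ : (fun t => _) = r \o (fun t => [ffun i : 'I_n => bit i t])); last first.
  by apply/funext => t; apply/ffunP => i; rewrite !ffunE.
rewrite law_comp; last by apply: finite_valued_ffun => i; exact: measurable_bit.
rewrite /push (eq_bigr (fun=> 2 ^- n)); last by move=> f _; rewrite law_bits.
rewrite sumr_const -[LHS]mulr_natr.
have := card_ffun_extension w ie'; rewrite card_bool card_ord cardsE.
move=> /(congr1 (fun k => k%:R : R)).
rewrite natrM !natrX => H.
apply: (@mulIf _ (2 ^+ #|I|)); first by rewrite expf_neq0// pnatr_eq0.
by rewrite -mulrA H !mulVf// expf_neq0// pnatr_eq0.
Qed.

End UniformBits.

Section ProbabilityConstructions.
Context {R : realType} {d1 d2 : measure_display}.
Context {X : measurableType d1} {Y : measurableType d2}.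

Lemma pushforward_probability (P : probability X R) (f : X -> Y) :
  measurable_fun setT f ->
  exists Q : probability Y R, forall A, Q A = P (f @^-1` A).
Proof.
move=> mf; pose g : {mfun X >-> Y} := HB.pack f (isMeasurableFun.Build _ _ _ _ f mf).
by exists (distribution P g).
Qed.

Lemma average_probability (I : finType) (P : I -> probability X R) : (0 < #|I|)%N ->
  exists Q : probability X R, forall A,
    Q A = ((#|I|%:R^-1)%:E * \sum_i P i A)%E.
Proof.
move=> I0.
have c0 : 0 <= #|I|%:R^-1 :> R by rewrite invr_ge0.
(* [msum] adds up a sequence indexed by the naturals, so the family is enumerated and padded with
   the zero measure. *)
pose m (n : nat) : {measure set X -> \bar R} :=
  if insub n is Some j then P (enum_val (j : 'I_#|I|)) else mzero.
pose q := mscale (NngNum c0) (msum m #|I|).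
have qE A : q A = ((#|I|%:R^-1)%:E * \sum_i P i A)%E.
  rewrite /q /mscale /= /msum; congr (_ * _)%E.
  rewrite [RHS](reindex (@enum_val I xpredT)) /=; last by apply: onW_bij; exact: enum_val_bij.
  by apply: eq_bigr => i _; rewrite /m valK.
have q1 : q setT = 1%E.
  rewrite qE (eq_bigr (fun=> 1%E)); last by move=> i _; rewrite probability_setT.
  rewrite sumEFin sumr_const -EFinM mulVf// pnatr_eq0 -lt0n.
  by [].
pose Q : probability X R := HB.pack q (Measure_isProbability.Build _ _ _ q q1).
by exists Q.
Qed.

End ProbabilityConstructions.

Section BernoulliMeasure.
Context {R : realType} {k : lattice_kind} {d : nat} {F : finType}.
Context {F2 : (1 < #|F|)%N}.
Local Notation Sigma := (config R k d F2).
Variables (a b : F).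
Hypothesis ab : a != b.

Lemma site_countable : exists e : site k d -> nat, injective e.
Proof.
case: (k) => /=.
  by exists (@pickle {ffun 'I_d -> int}); exact: pcan_inj pickleK.
by exists (@pickle {ffun 'I_d -> nat}); exact: pcan_inj pickleK.
Qed.

(** Enumerate the sites and let the symbol at a site be decided by the binary digit of that rank of
    a uniform real. Distinct sites read distinct digits. *)
Lemma bernoulli_exists : exists mu : probability Sigma R,
  forall (I : finType) (e : I -> site k d), injective e ->
  law mu (fun x => [ffun i => x (e i)]) =
  push (fun v : {ffun I -> bool} => [ffun i => if v i then b else a]) (fun=> 2 ^- #|I|).
Proof.
have [c ic] := site_countable.
pose cfg (t : R) : Sigma := fun s => if bit (c s) t then b else a.
pose word (I : finType) (e : I -> site k d) (t : R) := [ffun i => bit (c (e i)) t].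
have mword I e : finite_valued (@word I e).
  by apply: finite_valued_ffun => i; exact: measurable_bit.
pose h (I : finType) (v : {ffun I -> bool}) := [ffun i => if v i then b else a].
have mcfg : measurable_fun setT cfg.
  apply: (measurability (@open Sigma)) => //.
  move=> _ [A oA <-]; rewrite setTI -(open_core_cup oA) preimage_bigcup.
  apply: bigcup_measurable => n _.
  have [t [m [S ->]]] := determined_box (@open_core_determined _ _ _ _ _ A n).
  rewrite (_ : _ @^-1` _ = word _ (fun v => t + box_site k v) @^-1` [set v | S (h _ v)]).
    exact: (finite_valued_set (fun v => S (h _ v))).
  by apply/seteqP; split => s /=; congr S; apply/ffunP => v; rewrite !ffunE.
have [mu muE] := pushforward_probability (uniform_prob (@ltr01 R)) mcfg.
exists mu => I e ie; apply/funext => w.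
transitivity (law (uniform_prob (@ltr01 R)) (h I \o word I e) w).
  rewrite /law muE; congr (fine (_ _)); apply/seteqP; split => t /= <-.
    by apply/ffunP => i; rewrite !ffunE.
  by apply/ffunP => i; rewrite !ffunE.
rewrite law_comp; last exact: mword.
by apply: eq_bigr => v _; apply: law_bits_inj => i j /ic /ie.
Qed.

End BernoulliMeasure.

(** * Cosets of the lattice of period [N] *)

Section Lattices.
Context {k : lattice_kind} {d : nat}.
Implicit Types s t g : site k d.

Definition coord_mod (N : nat) : Defs.coord k -> nat :=
  match k return Defs.coord k -> nat with
  | FullLattice => fun c => absz (modz c N)
  | Orthant => fun c => (c %% N)%N
  end.

Lemma coord_mod_lt N c : (0 < N)%N -> (coord_mod N c < N)%N.
Proof. by rewrite /coord_mod; case: (k) c => /= c N0; lia. Qed.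

Lemma coord_modD N c c' : (0 < N)%N ->
  coord_mod N (c + c') = ((coord_mod N c + coord_mod N c') %% N)%N.
Proof.
rewrite /coord_mod; case: (k) c c' => /= c c' N0; last by rewrite modnDm.
apply/eqP; rewrite -eqz_nat -modz_nat PoszD !gez0_abs ?modz_ge0 ?modzDm//; lia.
Qed.

Lemma coord_mod_nat N (n : nat) : coord_mod N n%:R = (n %% N)%N.
Proof.
rewrite /coord_mod; case: (k).
  by rewrite [_%:R](natz n) modz_nat.
by rewrite [_%:R](natn n).
Qed.

Lemma coord_addI (a : Defs.coord k) : injective (+%R a).
Proof. by case: (k) a => /= a; [exact: addrI|exact: addnI]. Qed.

Lemma site_addI t : injective (+%R t : site k d -> site k d).
Proof.
move=> s s' /ffunP H; apply/ffunP => i; move: (H i); rewrite !site_addE.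
exact: coord_addI.
Qed.

Lemma box_site_inj n : injective (@box_site k d n).
Proof.
move=> u v /ffunP H; apply/ffunP => i; apply/val_inj; move: (H i).
by rewrite !box_siteE => /(congr1 (@coord_abs k)); rewrite !coord_absN.
Qed.

Definition on_lattice N (v : {ffun 'I_d -> 'I_N}) s : bool :=
  [forall i, coord_mod N ((s : {ffun 'I_d -> Defs.coord k}) i) == v i].

Lemma on_lattice_box N (v : {ffun 'I_d -> 'I_N}) n (u : {ffun 'I_d -> 'I_n}) :
  on_lattice v (box_site k u) = [forall i, (u i %% N == v i)%N].
Proof. by apply: eq_forallb => i; rewrite box_siteE coord_mod_nat. Qed.

(** Translations permute the cosets, which will make an average over all cosets translation
    invariant. *)
Lemma on_lattice_shift N g : (0 < N)%N -> exists2 sg : {ffun 'I_d -> 'I_N} -> {ffun 'I_d -> 'I_N},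
  injective sg & forall v s, on_lattice (sg v) (g + s) = on_lattice v s.
Proof.
move=> N0.
have P (i : 'I_d) (j : 'I_N) : 
    ((coord_mod N ((g : {ffun 'I_d -> Defs.coord k}) i) + j) %% N < N)%N.
  by rewrite ltn_pmod.
exists (fun v => [ffun i => Ordinal (P i (v i))]).
  move=> u v /ffunP H; apply/ffunP => i; apply/val_inj.
  move: (H i); rewrite !ffunE => -[] /eqP; rewrite eqn_modDl => /eqP.
  by rewrite !modn_small.
move=> v s; apply: eq_forallb => i; rewrite site_addE coord_modD// ffunE /= eqn_modDl.
by rewrite !modn_small// coord_mod_lt.
Qed.

End Lattices.

Lemma card_residue_ge n N (r : 'I_N) : (n %/ N <= #|[pred x : 'I_n | x %% N == r]|)%N.
Proof.
have P (y : 'I_(n %/ N)) : (y * N + r < n)%N.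
  apply: (@leq_trans (n %/ N * N)); last exact: leq_divM.
  by have := ltn_ord y; have := ltn_ord r; nia.
pose f y := Ordinal (P y).
have N0 : (0 < N)%N by exact: leq_ltn_trans (ltn_ord r).
have fi : injective f.
  move=> y z [] /addIn /eqP; rewrite eqn_pmul2r// => /eqP yz; exact: val_inj.
rewrite -[X in (X <= _)%N]card_ord -(card_codom fi); apply: subset_leq_card.
apply/fintype.subsetP => _ /codomP[y ->]; by rewrite inE /= modnMDl modn_small.
Qed.

Lemma card_residue_le n N (r : 'I_N) : (#|[pred x : 'I_(n * N) | x %% N == r]| <= n)%N.
Proof.
have N0 : (0 < N)%N by exact: leq_ltn_trans (ltn_ord r).
have P (x : 'I_(n * N)) : (x %/ N < n)%N by rewrite ltn_divLR.
rewrite -[X in (_ <= X)%N]card_ord.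
apply: (@leq_card_in _ _ (fun x => Ordinal (P x))) => x y.
rewrite !inE => /eqP xr /eqP yr [] xy; apply: val_inj => /=.
by rewrite (divn_eq x N) (divn_eq y N) xr yr xy.
Qed.

Section LatticeCount.
Context {k : lattice_kind} {d : nat}.

Lemma card_on_lattice N (v : {ffun 'I_d -> 'I_N}) n :
  #|[set u : {ffun 'I_d -> 'I_n} | on_lattice v (box_site k u)]%SET| =
  (\prod_i #|[pred x : 'I_n | x %% N == v i]|)%N.
Proof.
rewrite -(card_family_prod (fun i => [pred x : 'I_n | x %% N == v i]%N)).
by apply: eq_card => u; rewrite !inE on_lattice_box.
Qed.

Lemma card_on_lattice_ge N (v : {ffun 'I_d -> 'I_N}) n :
  ((n %/ N) ^ d <= #|[set u : {ffun 'I_d -> 'I_n} | on_lattice v (box_site k u)]%SET|)%N.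
Proof.
rewrite card_on_lattice -[X in (_ ^ X)%N](card_ord d) -prod_nat_const.
by apply: leq_prod => i _; exact: card_residue_ge.
Qed.

Lemma card_on_lattice_le N (v : {ffun 'I_d -> 'I_N}) n :
  (#|[set u : {ffun 'I_d -> 'I_(n * N)} | on_lattice v (box_site k u)]%SET| <= n ^ d)%N.
Proof.
rewrite card_on_lattice -[X in (_ <= _ ^ X)%N](card_ord d) -prod_nat_const.
by apply: leq_prod => i _; exact: card_residue_le.
Qed.

End LatticeCount.

(** * The random sparse measure *)

Section SparseMeasure.
Context {R : realType} {k : lattice_kind} {d : nat} {F : finType}.
Context {F2 : (1 < #|F|)%N}.
Local Notation Sigma := (config R k d F2).
Variables (f g : F) (N : nat).
Hypotheses (fg : f != g) (N0 : (0 < N)%N).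

Definition sparsify (v : {ffun 'I_d -> 'I_N}) (x : Sigma) : Sigma :=
  fun s => if on_lattice v s && (x s == g) then g else f.

Lemma measurable_sparsify v : measurable_fun setT (sparsify v).
Proof.
apply: (measurability (@open Sigma)) => //.
move=> _ [A oA <-]; rewrite setTI; apply: open_measurable_config.
apply/open_agree => x /= Ax; move/open_agree : oA => /(_ _ Ax)[n An].
by exists n => y xy; apply: An => s sn; rewrite /sparsify xy.
Qed.

(** The law on finitely many distinct sites depends on their number alone, so a cylinder and its
    translate have the same probability; probabilities that agree on determined sets coincide. *)
Lemma bernoulli_invariant : exists mu : probability Sigma R,
  translation_invariant mu /\
  forall (I : finType) (e : I -> site k d), injective e ->
  law mu (fun x => [ffun i => x (e i) == g]) = fun=> 2 ^- #|I|.
Proof.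
have [mu muE] := @bernoulli_exists R k d F F2 f g.
have mword (I : finType) (e : I -> site k d) :
    finite_valued (fun x : Sigma => [ffun i => x (e i)]).
  apply: finite_valued_ffun => i t.
  apply: (@determined_measurable _ _ _ _ _ (site_norm (e i)).+1) => x y xy /= <-.
  by rewrite xy.
exists mu; split => [h A mA|I e ie]; last first.
  pose beta (w : {ffun I -> F}) := [ffun i => w i == g].
  rewrite (_ : (fun x => _) = beta \o (fun x => [ffun i => x (e i)])); last first.
    by apply/funext => x; apply/ffunP => i; rewrite !ffunE.
  rewrite law_comp// muE//; apply/funext => z.
  rewrite (_ : push beta _ z = \sum_(v : {ffun I -> bool} | v == z) 2 ^- #|I|).
    by rewrite big_pred1_eq.
  (* After the exchange, each [v] contributes through the single word [w] it encodes, and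
     [beta w = v] because [f != g]. *)
  rewrite /push (exchange_big_dep xpredT)//= [RHS]big_mkcond/=.
  apply: eq_bigr => v _; set w := [ffun i => _].
  have bw : beta w = v.
    by apply/ffunP => i; rewrite !ffunE; case: (v i); rewrite ?eqxx// (negbTE fg).
  rewrite (eq_bigl (fun y => (y == w) && (v == z))).
    by case: eqP => _; [rewrite (eq_bigl (pred1 w)) ?big_pred1_eq// => y; rewrite andbT
                       |rewrite big_pred0// => y; rewrite andbF].
  move=> y; rewrite andbC eq_sym; case: eqP => //= ->.
  by rewrite bw.
have [Q QE] := pushforward_probability mu (@measurable_translate R k d F F2 h).
rewrite -QE; apply: config_prob_unique => // n B dB.
have [t [m [S ->]]] := determined_box dB.
have E (r : site k d) : @box_word R k d F F2 m \o translate r =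
    (fun x => [ffun i => x (r + box_site k i)]).
  by apply/funext => x; apply/ffunP => i; rewrite !ffunE.
have ie (r : site k d) : injective (fun i => r + @box_site k d m i).
  by move=> i j /site_addI /box_site_inj.
have mw r : finite_valued (@box_word R k d F F2 m \o translate r).
  by apply: finite_valued_translate; exact: finite_valued_box_word.
rewrite QE.
rewrite (_ : translate h @^-1` _ =
  (@box_word R k d F F2 m \o translate (h + t)) @^-1` [set w | S w]); last first.
  have tE (x : Sigma) : translate t (translate h x) = translate (h + t) x.
    by apply/funext => s; rewrite /translate addrA.
  by apply/seteqP; split => x /=; rewrite tE.
rewrite -[X in _ = mu X]/((@box_word R k d F F2 m \o translate t) @^-1` [set w | S w]).
rewrite -[LHS]fine_prob; last exact: (finite_valued_set S (mw (h + t))).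
rewrite -[RHS]fine_prob; last exact: (finite_valued_set S (mw t)).
congr (_%:E); rewrite (prob_law mu S (mw (h + t))) (prob_law mu S (mw t)).
apply: eq_bigr => w _.
by rewrite !E !muE.
Qed.

(** Sparsify the Bernoulli measure along each coset and average over the cosets to restore
    invariance. A coset has at least [(n %/ N) ^ d] sites in the box, and a given word prescribes a
    fair bit at each of them. *)
Lemma sparse_measure : exists nu : invariant_measure R k d F2,
  (forall A, measurable A -> (forall v x, A (sparsify v x)) -> nu A = 1%E) /\
  (forall n (w : {ffun {ffun 'I_d -> 'I_n} -> F}),
     law nu (@box_word R k d F F2 n) w <= 2 ^- ((n %/ N) ^ d)).
Proof.
have [mu [imu muE]] := bernoulli_invariant.
have hP v := pushforward_probability mu (measurable_sparsify v).
have [P PE] := choice hP.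
have I0 : (0 < #|{ffun 'I_d -> 'I_N}|)%N by rewrite card_ffun !card_ord expn_gt0 N0.
have [Q QE] := average_probability P I0.
have iQ : translation_invariant Q.
  move=> h A mA; rewrite !QE; congr (_ * _)%E.
  have [sg isg sgE] := @on_lattice_shift k d N h N0.
  rewrite [LHS](reindex_inj isg)/=; apply: eq_bigr => v _; rewrite !PE.
  rewrite -(imu h (sparsify v @^-1` A)); last first.
    by rewrite -[X in measurable X]setTI; apply: measurable_sparsify.
  congr (mu _); apply/seteqP; split => x /=;
  rewrite (_ : translate h (sparsify (sg v) x) = sparsify v (translate h x))//;
  by apply/funext => s; rewrite /translate /sparsify sgE.
exists (InvariantMeasure iQ); split => [A mA AT|n w] /=.
  rewrite QE (eq_bigr (fun=> 1%E)); last first.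
    move=> v _; rewrite PE (_ : _ @^-1` _ = setT) ?probability_setT//.
    by apply/seteqP; split => // x _; exact: AT.
  by rewrite sumEFin sumr_const -EFinM mulVf// pnatr_eq0 -lt0n.
set p := 2 ^- _; rewrite /law -lee_fin fine_prob; last exact: finite_valued_box_word.
rewrite QE lee_pdivrMl ?ltr0n//.
apply: (@le_trans _ _ (\sum_(v : {ffun 'I_d -> 'I_N}) p%:E)%E); last first.
  by rewrite sumEFin sumr_const -EFinM lee_fin mulr_natl.
apply: lee_sum => v _; rewrite PE.
pose I := {u : {ffun 'I_d -> 'I_n} | u \in [set u | on_lattice v (box_site k u)]%SET}.
pose e (i : I) := box_site k (val i).
have ie : injective e by move=> i j /box_site_inj /val_inj.
pose z : {ffun I -> bool} := [ffun i => w (val i) == g].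
have mz : measurable ((fun x : Sigma => [ffun i => x (e i) == g]) @^-1` [set z]).
  apply: (finite_valued_ffun (f := fun i (x : Sigma) => x (e i) == g)) => i t.
  apply: (@determined_measurable _ _ _ _ _ (site_norm (e i)).+1) => x y xy /= <-.
  by rewrite xy.
apply: (@le_trans _ _ (mu ((fun x : Sigma => [ffun i => x (e i) == g]) @^-1` [set z]))).
  apply: le_measure; rewrite ?inE//.
    by rewrite -[X in measurable X]setTI; apply: measurable_sparsify => //;
      exact: finite_valued_box_word.
  (* On the coset the sparsified configuration shows [g] exactly where [x] does, so the word fixes
     these bits of [x]. *)
  move=> x /= wE; apply/ffunP => i; rewrite !ffunE -wE ffunE /sparsify.
  have := valP i; rewrite inE => ->; rewrite /=.
  by case: ifPn; rewrite ?eqxx// => _; rewrite (negbTE fg).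
rewrite -fine_prob// lee_fin -/(law _ _ _) muE//.
rewrite lef_pV2 ?posrE ?exprn_gt0// ler_weXn2l ?ler1n//.
rewrite card_sig; apply: leq_trans (card_on_lattice_ge (k := k) v n) _.
by apply: subset_leq_card; apply/fintype.subsetP => u.
Qed.

End SparseMeasure.

(** * Counting sparse words *)

Section SparseWords.
Context {R : realType} {k : lattice_kind} {d : nat} {F : finType}.
Context {F2 : (1 < #|F|)%N}.
Local Notation Sigma := (config R k d F2).
Implicit Types (f g : F) (N M : nat).

Lemma sparse_entropy_ge N (nu : invariant_measure R k d F2) : (0 < N)%N ->
  (forall n (w : {ffun {ffun 'I_d -> 'I_n} -> F}),
     law nu (@box_word R k d F F2 n) w <= 2 ^- ((n %/ N) ^ d)) ->
  ((ln 2 / N%:R ^+ d)%:E <= entropy nu)%E.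
Proof.
move=> N0 H.
apply: (@entropy_ge _ _ _ _ _ _ (fun n => ((n %/ N)%:R / n%:R) ^+ d * ln 2)).
  move=> n; rewrite expr_div_n mulrAC ler_wpM2r ?invr_ge0 ?exprn_ge0//.
  rewrite -natrX; apply: shannon_ge => //; first by move=> t; exact: law_ge0.
  by apply: law_sum; exact: finite_valued_box_word.
rewrite mulrC -exprVn; apply: cvgMr_tmp.
apply: (@cvg_comp _ _ _ (fun n => (n %/ N)%:R / n%:R : R)
  (fun x : R => x ^+ d) _ (nbhs (N%:R^-1 : R))); last exact: exprn_continuous.
(* The block count with no margin and dimension 1; subtracting [1 / n] removes the successor. *)
have h : ((((n + 0) %/ N).+1%:R / n%:R) ^+ 1 - 1 / n%:R : R) @[n --> \oo] -->
    (N%:R^-1 ^+ 1 - 0 : R).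
  by apply: cvgB; [exact: cvg_block_count|exact: cvg_const_over_nat].
rewrite expr1 subr0 in h; apply: cvg_trans h; apply: near_eq_cvg; apply: nearW => n.
by rewrite expr1 addn0 -mulrBl -natr1 addrK.
Qed.

(* [f] is the background; [g] is allowed on one translate of the lattice [N Z^d]. *)
Definition sparse_word f g N M (w : {ffun {ffun 'I_d -> 'I_M} -> F}) : bool :=
  [exists v : {ffun 'I_d -> 'I_N}, [forall u,
    (w u == f) || ((w u == g) && on_lattice v (box_site k u))]].

(** There are [N ^ d] cosets; once one is chosen, two symbols are possible at its [(M %/ N) ^ d]
    sites in the window and one symbol elsewhere. *)
Lemma card_sparse_word f g N M : (0 < N)%N -> (N %| M)%N ->
  (#|[pred w | @sparse_word f g N M w]| <= N ^ d * 2 ^ ((M %/ N) ^ d))%N.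
Proof.
move=> N0 /dvdnP[n ->]; rewrite mulnK//.
pose G (v : {ffun 'I_d -> 'I_N}) (u : {ffun 'I_d -> 'I_(n * N)}) : pred F :=
  fun y => (y == f) || ((y == g) && on_lattice v (box_site k u)).
pose S v := [set w : {ffun {ffun 'I_d -> 'I_(n * N)} -> F} | [forall u, G v u (w u)]]%SET.
apply: (@leq_trans (\sum_(v : {ffun 'I_d -> 'I_N}) #|S v|)%N).
  under eq_bigr do rewrite -sum1_card big_mkcond/=.
  rewrite exchange_big/= -sum1_card big_mkcond/=; apply: leq_sum => w _.
  case: ifP => // /existsP[v wv].
  by rewrite (bigD1 v)//= inE wv leq_addr.
rewrite -[X in (X ^ d * _)%N](card_ord N) -[X in (_ ^ X * _)%N](card_ord d) -card_ffun.
rewrite -sum_nat_const; apply: leq_sum => v _; rewrite card_family_prod.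
apply: (@leq_trans (\prod_(u | on_lattice v (box_site k u)) 2)%N).
  rewrite [leqRHS]big_mkcond/=; apply: leq_prod => u _; case: ifP => ou.
    apply: (@leq_trans #|pred2 f g|); last by rewrite card2; case: (f != g).
    by apply: subset_leq_card; apply/fintype.subsetP => y; rewrite unfold_in /G ou andbT.
  rewrite -(card1 f); apply: subset_leq_card; apply/fintype.subsetP => y.
  by rewrite unfold_in /G ou andbF orbF.
rewrite prod_nat_const leq_exp2l//.
apply: leq_trans (card_on_lattice_le (k := k) v n).
by apply: subset_leq_card; apply/fintype.subsetP => u; rewrite !inE.
Qed.

Lemma sparse_word_density f g N M w : (0 < N)%N -> (N %| M)%N ->
  @sparse_word f g N M w -> (#|[pred u | w u != f]| <= (M %/ N) ^ d)%N.
Proof.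
move=> N0 /dvdnP[n Mn]; subst M; rewrite mulnK//.
move=> /existsP[v /forallP wv]; apply: leq_trans (card_on_lattice_le (k := k) v n).
apply: subset_leq_card; apply/fintype.subsetP => u; rewrite !inE => wu.
by have := wv u; rewrite (negbTE wu)/= => /andP[].
Qed.

(* [Some true]: sparse with background [f] and period [N]; [Some false]: sparse with
   background [g] and period [N']; [None]: illegal. *)
Definition word_class f g N N' M (w : {ffun {ffun 'I_d -> 'I_M} -> F}) : option bool :=
  if sparse_word f g N w then Some true
  else if sparse_word g f N' w then Some false else None.

Lemma big_option_bool (G : option bool -> R) :
  \sum_c G c = G (Some true) + G (Some false) + G None.
Proof.
rewrite (bigD1 (Some true))//= (bigD1 (Some false))//= (big_pred1 None) ?addrA//.
by case => [[]|].
Qed.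

Variable nu : invariant_measure R k d F2.

Definition class_prob f g N N' M (c : option bool) : R :=
  law nu (@word_class f g N N' M \o @box_word R k d F F2 M) c.

Lemma class_prob_sum f g N N' M :
  class_prob f g N N' M (Some true) + class_prob f g N N' M (Some false) +
  class_prob f g N N' M None = 1.
Proof.
rewrite -(law_sum nu (finite_valued_comp (@word_class f g N N' M)
  (@finite_valued_box_word R k d F F2 M))).
by rewrite big_option_bool.
Qed.

Lemma class_prob_ge0 f g N N' M c : 0 <= class_prob f g N N' M c.
Proof. exact: law_ge0. Qed.

Lemma class_scale (X a b c Y Z W m : R) : m != 0 ->
  (X / m + a * Y + b * Z + c * W) * m = X + a * (m * Y) + b * (m * Z) + c * (m * W).
Proof. by move=> m0; field. Qed.

(** The logarithms of the numbers of cosets are weighted by [a] and [b], and [a + b <= 1], so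
    together they cost at most [D * lN']. *)
Lemma class_weight_le (a b c D lN lN' l3 U V W : R) : 0 <= a -> 0 <= b -> 0 <= c ->
  a + b + c = 1 -> 0 <= D -> lN <= lN' -> 0 <= lN' ->
  l3 + (a * (D * lN + U) + b * (D * lN' + V) + c * W) <=
  l3 + D * lN' + a * U + b * V + c * W.
Proof.
move=> a0 b0 c0 abc D0 lNN' lN'0.
have h : a * (D * lN) + b * (D * lN') <= D * lN'.
  apply: (@le_trans _ _ ((a + b) * (D * lN'))).
    by rewrite mulrDl lerD2r ler_wpM2l// ler_wpM2l.
  by rewrite ler_piMl ?mulr_ge0//; lra.
by rewrite !mulrDr; lra.
Qed.

(** [shannon_class_le] with three classes: [ln 3] pays for the class, [d ln N'] for the coset, and
    each class then contributes its own entropy per site, the illegal one being bounded by all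
    words. *)
Lemma box_entropy_class_le f g N N' M :
  (0 < M)%N -> (0 < N)%N -> (N <= N')%N -> (N %| M)%N -> (N' %| M)%N ->
  rv_entropy nu (@box_word R k d F F2 M) / M%:R ^+ d <=
  (ln 3 + d%:R * ln N'%:R) / M%:R ^+ d +
  class_prob f g N N' M (Some true) * (ln 2 / N%:R ^+ d) +
  class_prob f g N N' M (Some false) * (ln 2 / N'%:R ^+ d) +
  class_prob f g N N' M None * ln #|F|%:R.
Proof.
move=> M0 N0 NN' NM N'M.
have N'0 : (0 < N')%N by exact: leq_trans NN'.
have mb := @finite_valued_box_word R k d F F2 M.
pose B (c : option bool) : R := match c with
  | Some true => (N ^ d * 2 ^ ((M %/ N) ^ d))%N%:R
  | Some false => (N' ^ d * 2 ^ ((M %/ N') ^ d))%N%:R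
  | None => (#|F| ^ (M ^ d))%N%:R end.
have B0 c : 0 < B c.
  by case: c => [[]|] /=; rewrite ltr0n ?muln_gt0 ?expn_gt0 ?N0 ?N'0// (ltnW F2).
have HB c : #|[pred w | @word_class f g N N' M w == c]|%:R <= B c.
  case: c => [[]|] /=; rewrite ler_nat.
  - apply: leq_trans (card_sparse_word f g N0 NM); apply: subset_leq_card.
    apply/fintype.subsetP => w; rewrite !inE /word_class.
    by case: ifP => // _; case: ifP.
  - apply: leq_trans (card_sparse_word g f N'0 N'M); apply: subset_leq_card.
    apply/fintype.subsetP => w; rewrite !inE /word_class.
    by case: ifP => // _; case: ifP.
  - by apply: leq_trans (max_card _) _; rewrite !card_ffun !card_ord.
have lnB (L : nat) : (0 < L)%N -> (L %| M)%N ->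
    ln (L ^ d * 2 ^ ((M %/ L) ^ d))%N%:R =
    d%:R * ln L%:R + M%:R ^+ d * (ln 2 / L%:R ^+ d) :> R.
  move=> L0 LM; have L0R : 0 < L%:R :> R by rewrite ltr0n.
  set q := ((M %/ L) ^ d)%N; have qE : q%:R = M%:R ^+ d / L%:R ^+ d :> R.
    by rewrite /q natrX natr_div ?unitfE ?gt_eqF// expr_div_n.
  rewrite natrM (natrX _ L) (natrX _ 2) lnM ?posrE ?exprn_gt0//.
  rewrite lnXn// lnXn// -[_ *+ d]mulr_natl -[_ *+ q]mulr_natl qE.
  by rewrite mulrA mulrAC.
have lnBF : ln (#|F| ^ (M ^ d))%N%:R = M%:R ^+ d * ln #|F|%:R :> R.
  by rewrite natrX lnXn ?ltr0n ?(ltnW F2)// -[_ *+ (M ^ d)%N]mulr_natl natrX.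
have Md : 0 < M%:R ^+ d :> R by rewrite exprn_gt0// ltr0n.
rewrite ler_pdivrMr//.
apply: le_trans (shannon_class_le _ (law_sum nu mb) B0 HB) _; first exact: law_ge0.
rewrite -law_comp// card_option card_bool big_option_bool /B !lnB// lnBF.
rewrite -!/(class_prob _ _ _ _ _ _).
have lnN : ln N%:R <= ln N'%:R :> R by rewrite ler_ln ?posrE ?ltr0n// ler_nat.
have lnN'0 : 0 <= ln N'%:R :> R by apply: ln_ge0; rewrite ler1n.
rewrite class_scale ?gt_eqF//; apply: class_weight_le => //.
- exact: class_prob_ge0.
- exact: class_prob_ge0.
- exact: class_prob_ge0.
- exact: class_prob_sum.
Qed.

(** By invariance the probability on the left may be averaged over the sites of the window. A
    favoured word has at most [(M %/ N) ^ d] sites off the background; any other word has at most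
    [M ^ d]. *)
Lemma density_le f g N N' M : (0 < M)%N -> (0 < N)%N -> (N %| M)%N ->
  fine (nu [set x | x 0 != f]) <=
  (N%:R ^+ d)^-1 + (1 - class_prob f g N N' M (Some true)).
Proof.
move=> M0 N0 NM.
have mb := @finite_valued_box_word R k d F F2 M.
have Md : 0 < M%:R ^+ d :> R by rewrite exprn_gt0// ltr0n.
have N0R : N%:R != 0 :> R by rewrite pnatr_eq0 -lt0n.
have m0 : measurable [set x : Sigma | x 0 != f].
  apply: (@determined_measurable _ _ _ _ _ (site_norm (0 : site k d)).+1) => x y xy /=.
  by rewrite xy.
pose p := law nu (@box_word R k d F F2 M).
have E (u : {ffun 'I_d -> 'I_M}) :
    fine (nu [set x | x 0 != f]) = \sum_(w : {ffun {ffun 'I_d -> 'I_M} -> F} | w u != f) p w.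
  rewrite -(prob_law nu (fun w : {ffun {ffun 'I_d -> 'I_M} -> F} => w u != f) mb); congr fine.
  rewrite -(invariant_probabilityP nu (box_site k u) m0); congr (_ _).
  by apply/seteqP; split => x; rewrite /= ffunE /translate addr0.
have card_box : (#|{ffun 'I_d -> 'I_M}| = M ^ d)%N by rewrite card_ffun !card_ord.
have : M%:R ^+ d * fine (nu [set x | x 0 != f]) <=
    M%:R ^+ d * ((N%:R ^+ d)^-1 + (1 - class_prob f g N N' M (Some true))).
  rewrite -[in leLHS]natrX -card_box mulr_natl -sumr_const (eq_bigr _ (fun u _ => E u)).
  rewrite (exchange_big_dep xpredT)//=.
  under eq_bigr do rewrite sumr_const.
  have cT : class_prob f g N N' M (Some true) = \sum_(w | sparse_word f g N w) p w.
    rewrite /class_prob law_comp//; apply: eq_bigl => w; rewrite /word_class.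
    by case: ifP => // _; case: ifP.
  have cF : 1 - class_prob f g N N' M (Some true) = \sum_(w | ~~ sparse_word f g N w) p w.
    apply/eqP; rewrite subr_eq cT -(law_sum nu mb) (bigID (fun w => sparse_word f g N w))/=.
    by rewrite addrC.
  rewrite mulrDr cF mulr_sumr.
  have -> : M%:R ^+ d / N%:R ^+ d = \sum_w p w * ((M %/ N) ^ d)%N%:R.
    by rewrite -mulr_suml law_sum// mul1r natrX natr_div ?unitfE// expr_div_n.
  rewrite [X in _ <= _ + X]big_mkcond -big_split/=; apply: ler_sum => w _.
  have pw : 0 <= p w by exact: law_ge0.
  rewrite -[p w *+ _]mulr_natr; case: ifPn => [nw|/negPn sw].
    rewrite ler_wpDl ?mulr_ge0// [leLHS]mulrC ler_wpM2r// -natrX ler_nat -card_box.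
    exact: max_card.
  by rewrite addr0 ler_wpM2l// ler_nat; exact: sparse_word_density sw.
by rewrite ler_pM2l.
Qed.

End SparseWords.

(** * Weak convergence to a constant configuration *)

Section WeakConvergence.
Context {R : realType} {k : lattice_kind} {d : nat} {F : finType}.
Context {F2 : (1 < #|F|)%N}.
Local Notation Sigma := (config R k d F2).

(** Tychonoff for the product of discrete copies of [F], carried over by the identity map, which is
    continuous into the metric topology. *)
Lemma config_compact : compact [set: Sigma].
Proof.
pose D := discrete_topology F.
pose T := prod_topology (fun _ : site k d => D).
have cT : compact [set: T].
  have := @tychonoff (site k d) (fun=> D) (fun=> [set: D])
    (fun=> finite_compact (@finite_finset F setT : finite_set [set: D])).
  by congr (compact _); apply/seteqP; split.
have ci : continuous (fun x : T => (x : Sigma)).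
  move=> x A /nbhs_agree[n nA].
  have [t [m tm]] := @site_ball_box k d n.
  have : nbhs (x : T) [set y : T | forall v : {ffun 'I_d -> 'I_m},
      y (t + box_site k v) = x (t + box_site k v)].
    apply: (@filter_forall _ _ (fun v : {ffun 'I_d -> 'I_m} =>
      [set y : T | y (t + box_site k v) = x (t + box_site k v)]) (nbhs (x : T))
      (nbhs_filter (x : T))) => v.
    have pc := @proj_continuous _ (fun _ : site k d => D) (t + box_site k v) x.
    exact: (pc _ (discrete_set1 (x (t + box_site k v) : D))).
  apply: filterS => y xy; apply: nA => s /tm[v ->].
  by rewrite -xy.
rewrite (_ : [set: Sigma] = (fun x : T => (x : Sigma)) @` [set: T]); last first.
  by apply/seteqP; split => // x _; exists x.
apply: continuous_compact => //; exact: continuous_subspaceT.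
Qed.

Lemma continuous_measurable_config (h : Sigma -> R) : continuous h -> measurable_fun setT h.
Proof.
move=> /continuousP ch; apply: (measurability _ (RGenOpens.measurableE R)).
move=> _ [_ [a [b ->] <-]]; rewrite setTI; apply: open_measurable_config.
exact/ch/interval_open.
Qed.

Lemma continuous_bounded_config (h : Sigma -> R) : continuous h ->
  exists2 B : R, 0 <= B & forall x, `|h x| <= B.
Proof.
move=> ch.
have : compact (h @` [set: Sigma]).
  by apply: continuous_compact config_compact; exact: continuous_subspaceT.
move=> /(@compact_bounded _ R^o)[M [_ HM]].
exists (`|M| + 1); first by rewrite addr_ge0.
move=> x; apply: (HM (`|M| + 1)); last by exists x.
by rewrite ltr_pwDr// ler_norm.
Qed.

Lemma integral_le_cst (nu : probability Sigma R) (D : set Sigma) (h : Sigma -> R) M :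
  measurable D -> measurable_fun setT h -> (forall x, 0 <= h x) ->
  (forall x, D x -> h x <= M) ->
  (\int[nu]_(x in D) (h x)%:E <= (M * fine (nu D))%:E)%E.
Proof.
move=> mD mh h0 hM; rewrite EFinM fine_prob// -integral_cst//.
apply: ge0_le_integral => //.
- by move=> x _; rewrite lee_fin.
- by apply/measurable_EFinP; exact: measurable_funTS.
Qed.

Lemma measurable_coordinate_neq (s : site k d) (f : F) :
  measurable [set x : Sigma | x s != f].
Proof.
apply: (@determined_measurable _ _ _ _ _ (site_norm s).+1) => x y xy /=.
by rewrite xy.
Qed.

Lemma prob_coordinate_neq (nu : invariant_measure R k d F2) (s : site k d) (f : F) :
  fine (nu [set x | x s != f]) = fine (nu [set x | x 0 != f]).
Proof.
rewrite -(invariant_probabilityP nu s (measurable_coordinate_neq 0 f)).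
congr (fine (_ _)).
by apply/seteqP; split => x; rewrite /= /translate addr0.
Qed.

(** On the event [E] that a large box shows only [f], [h] is within [e / 2] of its value at the
    constant configuration. Off [E] the difference is at most [2 * B], and a union bound over the
    sites of the box makes that event unlikely. *)
Lemma integral_near_constant (h : Sigma -> R) (f : F) : continuous h ->
  forall e : R, 0 < e -> exists2 del : R, 0 < del &
  forall nu : invariant_measure R k d F2, fine (nu [set x | x 0 != f]) < del ->
  `|(\int[nu]_x h x)%R - h (fun=> f)| < e.
Proof.
move=> ch e e0; have [B B0 hB] := continuous_bounded_config ch.
set xf : Sigma := fun=> f.
have [n hn] : exists n, forall y, agree n xf y -> `|h y - h xf| <= e / 2.
  have : nbhs xf [set y | `|h y - h xf| <= e / 2].
    have e2 : 0 < e / 2 by rewrite divr_gt0.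
    have /cvgrPdist_le/(_ _ e2) := ch xf.
    by apply: filterS => y /=; rewrite distrC.
  by move/nbhs_agree => [n Hn]; exists n.
have [t [m tm]] := @site_ball_box k d n.
pose E : set Sigma := [set x | box_word m (translate t x) = [ffun=> f]].
have mE : measurable E.
  exact: (finite_valued_translate t (@finite_valued_box_word R k d F F2 m) [ffun=> f]).
pose L : R := (m ^ d)%N%:R.
(* Chosen so that [2 * B * (L * q) < e / 2] when [q] is below it; the [+ 1] covers [B = 0]. *)
exists (e / (4 * (B * L + 1))); first by rewrite divr_gt0// mulr_gt0// ltr_wpDl// mulr_ge0.
move=> nu nuf.
have nuE : fine (nu (~` E)) <= L * fine (nu [set x | x 0 != f]).
  apply: (@le_trans _ _ (\sum_(v : {ffun 'I_d -> 'I_m}) 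
      fine (nu [set x | x (t + box_site k v) != f]))).
    apply: le_trans (fine_prob_bigsetU_le nu (index_enum _)
      (fun v => measurable_coordinate_neq (t + box_site k v) f)).
    apply: le_fine_prob; [exact: measurableC| |].
      by apply: bigsetU_measurable => v _; exact: measurable_coordinate_neq.
    move=> x /= nEx; rewrite -bigcup_seq; apply: contrapT => nx; apply: nEx.
    apply/ffunP => v; rewrite !ffunE; apply/eqP/negPn/negP => xv; apply: nx.
    by exists v => //=; rewrite mem_index_enum.
  rewrite (eq_bigr (fun=> fine (nu [set x | x 0 != f]))); last first.
    by move=> v _; exact: prob_coordinate_neq.
  by rewrite sumr_const card_ffun !card_ord /L mulr_natl.
have mh := continuous_measurable_config ch.
have bint (u : Sigma -> R) (C : R) : measurable_fun setT u -> (forall x, `|u x| <= C) ->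
    nu.-integrable setT (EFin \o u).
  move=> mu uC; apply: measurable_bounded_integrable => //.
    by rewrite (le_lt_trans (probability_le1 nu _))// ltry.
  exists C; split; first exact: num_real.
  move=> C' CC' x _ /=; exact: le_trans (uC x) (ltW CC').
have ih := bint h B mh hB.
have ic := bint (fun=> h xf) B (measurable_cst _) (fun=> hB xf).
have mg : measurable_fun setT (fun x => h x - h xf) by exact: measurable_funB.
have gB x : `|h x - h xf| <= 2 * B.
  apply: le_trans (ler_normB _ _) _.
  by have := hB x; have := hB xf; lra.
have ig := bint _ _ mg gB.
have -> : (\int[nu]_x h x)%R - h xf = (\int[nu]_x (h x - h xf))%R.
  rewrite RintegralB// Rintegral_cst//.
  by rewrite (_ : fine (nu [set: Sigma]) = 1) ?mulr1//; exact: (congr1 fine (probability_setT nu)).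
apply: le_lt_trans (le_normr_Rintegral _ ig) _ => //.
pose g : Sigma -> R := fun x => `|h x - h xf|.
have mn : measurable_fun setT g by exact: measurableT_comp.
have g0 x : 0 <= g x by exact: normr_ge0.
have I1 : (\int[nu]_x (g x)%:E <= (e / 2 + 2 * B * (L * fine (nu [set x | x 0 != f])))%:E)%E.
  have mf : measurable_fun (E `|` ~` E) (EFin \o g).
    by rewrite setUv; apply/measurable_EFinP.
  have f0 x : (E `|` ~` E) x -> (0 <= (EFin \o g) x)%E by rewrite lee_fin.
  have EC : [disjoint E & ~` E] by rewrite disj_set2E setICr.
  rewrite -(setUv E) (ge0_integral_setU nu mE (measurableC mE) mf f0 EC).
  rewrite EFinD; apply: leeD.
    apply: (@le_trans _ _ (e / 2 * fine (nu E))%:E).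
      apply: integral_le_cst => // x Ex; apply: hn => s /tm[v ->].
      by have /ffunP/(_ v) := Ex; rewrite !ffunE.
    by rewrite lee_fin; apply: ler_piMr; [rewrite divr_ge0// ltW|exact: fine_prob_le1].
  apply: (@le_trans _ _ (2 * B * fine (nu (~` E)))%:E).
    exact: (integral_le_cst nu (measurableC mE) mn g0 (fun x _ => gB x)).
  by rewrite lee_fin ler_wpM2l// mulr_ge0.
have I0 : (0 <= \int[nu]_x (g x)%:E)%E.
  by apply: integral_ge0 => x _; rewrite lee_fin.
have Ifin : (\int[nu]_x (g x)%:E)%E \is a fin_num.
  by rewrite ge0_fin_numE// (le_lt_trans I1)// ltry.
rewrite /Rintegral -lte_fin fineK// (le_lt_trans I1)// lte_fin.
set q := fine _ in nuf *; have BL : 0 <= B * L by rewrite mulr_ge0.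
have q0 : 0 <= q by exact: fine_prob_ge0.
have : (B * L) * q <= (B * L + 1) * q by rewrite ler_wpM2r// lerDl.
move: nuf; rewrite ltr_pdivlMr; last by rewrite mulr_gt0// ltr_wpDl.
lra.
Qed.

End WeakConvergence.

(** * Accumulation at the Dirac masses of constant configurations *)

Section Cluster.
Context {R : realType} {k : lattice_kind} {d : nat} {F : finType}.
Context {F2 : (1 < #|F|)%N}.
Local Notation Sigma := (config R k d F2).

Lemma dirac_invariant (f : F) :
  translation_invariant (@dirac _ Sigma (fun=> f) R : probability Sigma R).
Proof. by move=> g A mA; rewrite /= !diracE. Qed.

Definition constant_measure (f : F) : invariant_measure R k d F2 :=
  InvariantMeasure (dirac_invariant f).

Lemma constant_measure_pairing f (h : continuousType Sigma R) :
  integral_pairing (constant_measure f) h = h (fun=> f).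
Proof.
rewrite /integral_pairing /Rintegral integral_dirac//; last first.
  apply/measurable_EFinP; apply: continuous_measurable_config; exact: cts_fun.
by rewrite diracE in_setT mul1e.
Qed.

Lemma ptws_cvgP (U : choiceType) (G : set_system (U -> R)) (f : U -> R) :
  Filter G -> (forall u, (fun g => g u) @ G --> f u) -> G --> (f : {ptws U -> R}).
Proof.
move=> FG Gf; rewrite cvg_sup => i.
(* [cvg_image] wants the evaluation at [i] to be onto, which the constant functions show. *)
rewrite cvg_image; last by rewrite eqEsubset; split=> v // _; exists (cst v).
move=> W /= /Gf Q; exists (@^~ i @^-1` W) => //.
by rewrite eqEsubset; split => [j [? + <-//]|j Wj]; exists (fun _ => j).
Qed.

Lemma cvg_constant_measure (nu : nat -> invariant_measure R k d F2) (f : F) :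
  fine (nu n [set x | x 0 != f]) @[n --> \oo] --> (0 : R) ->
  nu n @[n --> \oo] --> constant_measure f.
Proof.
move=> nu0.
have H : integral_pairing (nu n) @[n --> \oo] --> integral_pairing (constant_measure f).
  apply: ptws_cvgP => h; rewrite constant_measure_pairing; apply/cvgrPdist_lt => e e0.
  have [del del0 hdel] := integral_near_constant f (@cts_fun _ _ h) e0.
  move/cvgrPdist_lt : nu0 => /(_ _ del0); apply: filterS => n.
  by rewrite sub0r normrN ger0_norm ?fine_prob_ge0// => /hdel; rewrite distrC.
move=> A /= [_ [[B Bop <-] Bf BA]].
have nB : nbhs (integral_pairing (constant_measure f)) B by exact: open_nbhs_nbhs.
have HB : \forall n \near \oo, B (integral_pairing (nu n)) := H B nB.
by move: HB; rewrite nbhs_filterE /= => HB; apply: (@filterS _ \oo) HB => n /BA.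
Qed.

(** The bound [n <= u n] takes [u] beyond every rank, so each tail of [rho] meets each neighbourhood
    of the limit. *)
Lemma cluster_constant_measure (rho : nat -> invariant_measure R k d F2) (f : F) (u : nat -> nat) :
  (forall n, (n <= u n)%N) ->
  fine (rho (u n) [set x | x 0 != f]) @[n --> \oo] --> (0 : R) ->
  cluster (rho l @[l --> \oo]) (constant_measure f).
Proof.
move=> nu_ /cvg_constant_measure uf A B [N _ NA] /uf [M _ MB].
exists (rho (u (maxn N M))); split.
  by apply: NA => /=; rewrite (leq_trans (leq_maxl _ _) (nu_ _)).
by apply: MB => /=; rewrite leq_maxr.
Qed.

Lemma constant_measure_supported (f : F) (U : set Sigma) :
  U (fun=> f) -> supported_on U (constant_measure f).
Proof.
by move=> Uf; rewrite /supported_on /= diracE memNset//= => nU; apply: nU.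
Qed.

End Cluster.

(** * Lipschitz norms and integrals of nonpositive functions *)

Section Lipschitz.
Context {R : realType} {k : lattice_kind} {d : nat} {F : finType}.
Context {F2 : (1 < #|F|)%N}.
Local Notation Sigma := (config R k d F2).

Lemma lipschitz_bound_continuous (h : Sigma -> R) (eta : R) :
  (forall x y, `|h x - h y| <= eta * mdist x y) -> continuous h.
Proof.
move=> hlip x; apply/(@cvgrPdist_lt _ _ _ (nbhs x) (nbhs_filter x)) => e e0.
rewrite near_simpl; apply/nbhs_ballP.
have eta1 : 0 < `|eta| + 1 by rewrite ltr_wpDl.
exists (e / (`|eta| + 1)) => /=; first by rewrite divr_gt0.
move=> y; rewrite ballEmdist/= ltr_pdivlMr// => xy.
apply: le_lt_trans (hlip x y) (le_lt_trans _ xy); rewrite mulrC ler_wpM2l ?mdist_ge0//.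
by rewrite ler_wpDr// ler_norm.
Qed.

Lemma lip_norm_le (h : Sigma -> R) (B eta : R) : 0 <= B -> 0 <= eta ->
  (forall x, `|h x| <= B) -> (forall x y, `|h x - h y| <= eta * mdist x y) ->
  (lip_norm h <= (B + eta)%:E)%E.
Proof.
move=> B0 eta0 hB hlip; rewrite EFinD; apply: leeD; apply: ge_ereal_sup.
  by move=> _ [x _ <-]; rewrite lee_fin.
move=> _ [[x y] /= xy <-]; rewrite lee_fin ler_pdivrMr//.
by rewrite mdist_gt0; apply/eqP.
Qed.

Lemma integral_nonpos_le (nu : probability Sigma R) (h : Sigma -> R) (A : set Sigma) m :
  measurable_fun setT h -> (forall x, h x <= 0) -> measurable A ->
  (forall x, A x -> h x <= - m) ->
  (\int[nu]_x (h x)%:E <= (- (m * fine (nu A)))%:E)%E.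
Proof.
move=> mh h0 mA hA; pose g x := - h x.
have mg : measurable_fun setT g by exact: measurableT_comp.
rewrite (eq_integral (fun x => - (g x)%:E)%E); last by move=> x _; rewrite /g EFinN oppeK.
rewrite integral_ge0N; last by move=> x _; rewrite lee_fin /g oppr_ge0.
rewrite EFinN leeN2 EFinM fine_prob//.
apply: (@le_trans _ _ (\int[nu]_(x in A) (g x)%:E)%E).
  have [m0|m0] := leP 0 m.
    rewrite -integral_cst//; apply: ge0_le_integral => //.
    - by apply/measurable_EFinP; exact: measurable_funTS.
    - by move=> x Ax; rewrite lee_fin lerNr hA.
  (* For negative [m] the left side is at most zero while the integrand is nonnegative. *)
  apply: (@le_trans _ _ 0%E); first by rewrite mule_le0_ge0// lee_fin ltW.
  by apply: integral_ge0 => x _; rewrite lee_fin oppr_ge0.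
apply: ge0_subset_integral => //; first exact/measurable_EFinP.
by move=> x _; rewrite lee_fin oppr_ge0.
Qed.

Lemma integral_nonpos_ge (nu : probability Sigma R) (h : Sigma -> R) (A : set Sigma) m :
  measurable_fun setT h -> (forall x, h x <= 0) -> measurable A -> nu A = 1%E ->
  (forall x, A x -> - m <= h x) ->
  ((- m)%:E <= \int[nu]_x (h x)%:E)%E.
Proof.
move=> mh h0 mA A1 hA; pose g x := - h x.
have mg : measurable_fun setT g by exact: measurableT_comp.
have g0 x : 0 <= g x by rewrite oppr_ge0.
rewrite (eq_integral (fun x => - (g x)%:E)%E); last by move=> x _; rewrite /g EFinN oppeK.
rewrite integral_ge0N; last by move=> x _; rewrite lee_fin.
rewrite EFinN leeN2.
have mf : measurable_fun (A `|` ~` A) (EFin \o g).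
  by rewrite setUv; apply/measurable_EFinP.
have f0 x : (A `|` ~` A) x -> (0 <= (EFin \o g) x)%E by rewrite lee_fin.
have AC : [disjoint A & ~` A] by rewrite disj_set2E setICr.
rewrite -(setUv A) (ge0_integral_setU nu mA (measurableC mA) mf f0 AC).
have NC : nu (~` A) = 0%E by rewrite probability_setC// A1 subee.
have mgC : measurable_fun (~` A) (EFin \o g).
  by apply/measurable_EFinP; exact: measurable_funTS.
rewrite [X in (_ + X)%E](null_set_integral (measurableC mA) mgC NC).
rewrite adde0; apply: le_trans (integral_le_cst nu mA mg g0 (M := m) _) _.
  by move=> x Ax; rewrite lerNl hA.
by rewrite A1 mulr1.
Qed.

End Lipschitz.

(** * The potential *)

Section Potential.
Context {R : realType} {k : lattice_kind} {d : nat} {F : finType}.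
Context {F2 : (1 < #|F|)%N}.
Local Notation Sigma := (config R k d F2).
Variables (D : nat -> Sigma -> bool) (r : nat -> nat) (c : nat -> R).
Hypothesis D_agree : forall j x y, agree (r j) x y -> D j x = D j y.
Hypothesis c_ge0 : forall j, 0 <= c j.
Hypothesis c_homo : forall i j, (i <= j)%N -> c j <= c i.

(** As [c] is nonincreasing, this charges the largest penalty among the levels where [D j x] holds,
    not their sum. *)
Definition first_penalty (x : Sigma) : R :=
  if pselect (exists j, D j x) is left h then - c (ex_minn h) else 0.

Variant first_penalty_spec x : R -> Prop :=
| FirstPenalty j of D j x & (forall i, (i < j)%N -> ~~ D i x) : first_penalty_spec x (- c j)
| NoPenalty of (forall j, ~~ D j x) : first_penalty_spec x 0.

Lemma first_penaltyP x : first_penalty_spec x (first_penalty x).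
Proof.
rewrite /first_penalty; case: pselect => [h|h].
  case: ex_minnP => j Dj jmin; constructor => // i; apply: contraTN => /jmin.
  by rewrite leqNgt.
by constructor => j; apply/negP => Dj; apply: h; exists j.
Qed.

Lemma first_penalty_le0 x : first_penalty x <= 0.
Proof. by case: first_penaltyP => // j _ _; rewrite oppr_le0. Qed.

Lemma first_penalty_le j x : D j x -> first_penalty x <= - c j.
Proof.
move=> Dj; case: first_penaltyP => [i Di imin|/(_ j)]; last by rewrite Dj.
by rewrite lerN2 c_homo// leqNgt; apply/negP => /imin; rewrite Dj.
Qed.

Lemma first_penalty_ge j x : (forall i, (i < j)%N -> ~~ D i x) -> - c j <= first_penalty x.
Proof.
move=> jD; case: first_penaltyP => [i Di imin|_]; last by rewrite oppr_le0.
by rewrite lerN2 c_homo// leqNgt; apply/negP => /jD; rewrite Di.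
Qed.

Lemma first_penalty_norm x : `|first_penalty x| <= c 0.
Proof. by rewrite ler0_norm ?first_penalty_le0// lerNl first_penalty_ge. Qed.

(** Let [j] be the first level that tells [x] from [y]. If an earlier level charges [x], it charges
    [y] equally. Otherwise both values lie between [- c j] and 0, while [x] and [y] are at distance
    at least [2 ^- r j]. *)
Lemma first_penalty_lip eta : (forall j, c j * 2 ^+ r j <= eta) ->
  forall x y, `|first_penalty x - first_penalty y| <= eta * mdist x y.
Proof.
move=> ceta x y.
have eta0 : 0 <= eta by apply: le_trans (ceta 0%N); rewrite mulr_ge0// exprn_ge0.
have [[j Dj]|noj] := pselect (exists j, D j x != D j y); last first.
  have Dxy j : D j x = D j y by apply/eqP/negPn/negP => h; apply: noj; exists j.
  rewrite (_ : first_penalty x = first_penalty y) ?subrr ?normr0 ?mulr_ge0 ?mdist_ge0//.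
  case: (first_penaltyP x) => [i Di imin|nx]; case: (first_penaltyP y) => [l Dl lmin|ny] //.
  - have [li|li|il] := ltngtP l i.
    + by have := imin _ li; rewrite Dxy Dl.
    + by have := lmin _ li; rewrite -Dxy Di.
    + exact: (congr1 (fun z => - c z) (esym il)).
  - by have := ny i; rewrite -Dxy Di.
  - by have := nx l; rewrite Dxy Dl.
have [{Dj}j Dj jmin] := ex_minnP (ex_intro (fun j => D j x != D j y) j Dj).
have eqD i : (i < j)%N -> D i x = D i y.
  by move=> ij; apply/eqP/negPn/negP => /jmin; rewrite leqNgt ij.
have [[i ij Di]|noi] := pselect (exists2 i, (i < j)%N & D i x).
  have [{}i /andP[{}ij {}Di] imin] := ex_minnP (ex_intro (fun i => (i < j)%N && D i x) i
    (introT andP (conj ij Di))).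
  have val z : (forall l, (l < j)%N -> D l z = D l x) -> first_penalty z = - c i.
    move=> zx; case: first_penaltyP => [l Dl lmin|/(_ i)]; last by rewrite zx// Di.
    have [li|li|-> //] := ltngtP l i.
      have lj := ltn_trans li ij.
      by have := imin l; rewrite lj -zx// Dl leqNgt li => /(_ isT).
    by have := lmin _ li; rewrite zx// Di.
  rewrite (val x)// (val y); last by move=> l lj; rewrite eqD.
  by rewrite subrr normr0 mulr_ge0 ?mdist_ge0.
have nx i : (i < j)%N -> ~~ D i x by move=> ij; apply/negP => Di; apply: noi; exists i.
have ny i : (i < j)%N -> ~~ D i y by move=> ij; rewrite -eqD// nx.
apply: (@le_trans _ _ (c j)).
  have := first_penalty_ge nx; have := first_penalty_ge ny.
  have := first_penalty_le0 x; have := first_penalty_le0 y.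
  by rewrite ler_norml; lra.
have xyr : 2 ^- r j <= mdist x y.
  rewrite leNgt; apply/negP => /mdist_agree/D_agree xy.
  by rewrite xy eqxx in Dj.
apply: le_trans (ler_wpM2l eta0 xyr).
by rewrite ler_pdivlMr ?exprn_gt0.
Qed.

End Potential.

(** * Comparison of entropies at one level *)

Section Selection.
Context {R : realType} {k : lattice_kind} {d : nat} {F : finType}.
Context {F2 : (1 < #|F|)%N}.
Local Notation Sigma := (config R k d F2).

(** Each window outside the favoured class forfeits at least half of the rate [L], and [t + tau]
    bounds the total loss. *)
Lemma selection_bound (L tau t pW pL pI V : R) : 0 < L -> 0 <= pL -> 0 <= pI ->
  pW + pL + pI = 1 -> V <= L / 2 ->
  L - t <= tau + pW * L + pL * V -> 1 - pW <= 2 * (t + tau) / L.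
Proof.
move=> L0 pL0 pI0 p1 VL H; rewrite ler_pdivlMr//.
have : pL * V <= pL * (L / 2) by rewrite ler_wpM2l.
have : 0 <= pI * L by rewrite mulr_ge0// ltW.
have -> : pW = 1 - pL - pI by lra.
by move: H; rewrite (_ : pW = 1 - pL - pI); [lra|lra].
Qed.

(** The pressure is bounded below by the free energy of [nu] and above by the entropy of one window
    under [rho] plus its energy. The energy [- ln #|F| * pI] cancels the illegal term of
    [box_entropy_class_le]. *)
Lemma equilibrium_class_bound (h : Sigma -> R) (nu rho : invariant_measure R k d F2)
    (f g : F) (N M : nat) (Y : set Sigma) (t : R) :
  (0 < d)%N -> (0 < N)%N -> (0 < M)%N -> (2 * N %| M)%N ->
  measurable_fun setT h -> (forall x, h x <= 0) ->
  (forall x, @word_class k d F f g N (2 * N) M (box_word M x) = None -> h x <= - ln #|F|%:R) ->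
  measurable Y -> nu Y = 1%E -> (forall x, Y x -> - t <= h x) ->
  ((ln 2 / N%:R ^+ d)%:E <= entropy nu)%E ->
  equilibrium_state h rho ->
  1 - class_prob rho f g N (2 * N) M (Some true) <=
    2 * (t + (ln 3 + d%:R * ln (2 * N)%N%:R) / M%:R ^+ d) / (ln 2 / N%:R ^+ d).
Proof.
move=> d0 N0 M0 NM mh h0 hI mY Y1 hY Hnu Hrho.
set pW := class_prob _ _ _ _ _ _ (Some true).
set pL := class_prob rho f g N (2 * N) M (Some false).
set pI := class_prob rho f g N (2 * N) M None.
have N0R : 0 < N%:R :> R by rewrite ltr0n.
have ln20 : 0 < ln 2 :> R by rewrite ln_gt0// ltr1n.
have lower : ((ln 2 / N%:R ^+ d - t)%:E <= pressure h)%E.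
  apply: (@le_trans _ _ (free_energy h nu)); last by apply: ereal_sup_ubound; exists nu.
  rewrite EFinD; apply: leeD => //.
  exact: integral_nonpos_ge mh h0 mY Y1 hY.
pose cl := @word_class k d F f g N (2 * N) M \o @box_word R k d F F2 M.
have mcl : finite_valued cl.
  by apply: finite_valued_comp; exact: finite_valued_box_word.
have upper : (pressure h <=
    (rv_entropy rho (@box_word R k d F F2 M) / M%:R ^+ d - ln #|F|%:R * pI)%:E)%E.
  rewrite -Hrho EFinD; apply: leeD; first exact: entropy_le.
  by apply: integral_nonpos_le => //; exact: mcl.
have := le_trans lower upper; rewrite lee_fin.
have NM' : (N %| M)%N by apply: dvdn_trans NM; exact: dvdn_mull.
have N2N : (N <= 2 * N)%N by lia.
have := box_entropy_class_le rho f g M0 N0 N2N NM' NM; rewrite -/pW -/pL -/pI => hub hlow.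
apply: (@selection_bound _ _ _ _ pL pI (ln 2 / (2 * N)%N%:R ^+ d)).
- by rewrite divr_gt0// exprn_gt0.
- exact: class_prob_ge0.
- exact: class_prob_ge0.
- exact: class_prob_sum.
(* Here [d >= 1] matters: doubling the period divides the rate by [2 ^ d], hence at least by 2. *)
- rewrite -mulrA ler_pM2l// -invfM lef_pV2 ?posrE ?mulr_gt0 ?exprn_gt0 ?ltr0n ?muln_gt0//.
  rewrite natrM exprMn mulrC ler_pM2r ?exprn_gt0//.
  by rewrite -[leLHS]expr1 ler_weXn2l// ler1n.
- move: hub hlow; set X := rv_entropy _ _ / _; rewrite (mulrC (ln #|F|%:R)); lra.
Qed.

Lemma exists_window (X tau : R) (L : nat) : 0 <= X -> 0 < tau -> (0 < L)%N -> (0 < d)%N ->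
  exists M, [/\ (0 < M)%N, (L %| M)%N & X / M%:R ^+ d <= tau].
Proof.
move=> X0 tau0 L0 d0; set n := (Num.truncn (X / tau)).+1.
have M0 : (0 < L * n)%N by rewrite muln_gt0 L0.
exists (L * n)%N; split => //; first exact: dvdn_mulr.
rewrite ler_pdivrMr ?exprn_gt0 ?ltr0n// -ler_pdivrMl// mulrC.
apply: (@le_trans _ _ n%:R); first by rewrite ltW// Num.Theory.truncnS_gt.
rewrite -natrX ler_nat; apply: (@leq_trans (L * n)); first exact: leq_pmull.
by rewrite -[X in (X <= _)%N]expn1 leq_pexp2l.
Qed.

Lemma coord_mod_dvdn N N' (c : Defs.coord k) : (0 < N)%N -> (N %| N')%N -> (0 < N')%N ->
  coord_mod N c = (coord_mod N' c %% N)%N.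
Proof.
rewrite /coord_mod; case: (k) c => /= c N0 NN' N'0; last by rewrite modn_dvdm.
apply/eqP; rewrite -eqz_nat -modz_nat !gez0_abs ?modz_ge0; try lia.
have /dvdnP[q N'q] := NN'.
have E : c = (c %/ N')%Z * q%:Z * N%:Z + (c %% N')%Z.
  by rewrite -mulrA -PoszM -N'q -divz_eq.
by rewrite {1}E modzMDl eqxx.
Qed.

(** A coset of the coarser lattice of period [N'] lies in one coset of the lattice of period [N],
    found by reducing its residues. *)
Lemma sparsify_sparse (f g : F) N N' M v (x : Sigma) : (0 < N)%N -> (N %| N')%N -> (0 < N')%N ->
  @sparse_word k d F f g N M (box_word M (@sparsify R k d F F2 f g N' v x)).
Proof.
move=> N0 NN' N'0.
have P (j : 'I_N') : (j %% N < N)%N by rewrite ltn_pmod.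
apply/existsP; exists [ffun i => Ordinal (P (v i))].
apply/forallP => u; rewrite ffunE /sparsify.
have [ov|_] := boolP (on_lattice v (box_site k u)); last by rewrite eqxx.
case: (x (box_site k u) == g); last by rewrite eqxx.
rewrite eqxx /=; apply/orP; right; apply/forallP => i.
rewrite (coord_mod_dvdn _ N0 NN' N'0) (eqP (forallP ov i)); apply/eqP.
by apply/esym; rewrite ffunE.
Qed.

End Selection.

(** * Choice of the inverse temperatures *)

Section Schedule.
Context {R : realType}.

(** [X n p] is the threshold for the [n]-th chosen term when the preceding one is [p]; the first
    term has no predecessor and uses [p = 0]. *)
Lemma fast_subsequence (beta : nat -> R) (X : nat -> R -> R) :
  beta l @[l --> \oo] --> +oo ->
  exists l : nat -> nat, (forall n, (n <= l n)%N) /\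
    X 0%N 0 <= beta (l 0%N) /\ (forall n, X n.+1 (beta (l n)) <= beta (l n.+1)).
Proof.
move=> /cvgryPge boo.
have pick (p : nat * R) : exists l, (p.1 <= l)%N /\ p.2 <= beta l.
  have [N _ HN] := boo p.2; exists (maxn p.1 N); rewrite leq_maxl; split => //.
  by apply: HN => /=; rewrite leq_maxr.
have [s hs] := choice pick.
pose l := fix l n := if n is m.+1 then s (m.+1, X m.+1 (beta (l m))) else s (0%N, X 0%N 0).
exists l; split; first by case=> [//|n]; exact: (hs (n.+1, _)).1.
by split => [|n]; [exact: (hs (0%N, _)).2|exact: (hs (n.+1, _)).2].
Qed.

End Schedule.

(** * Selection of the favoured background *)

Section Phases.
Context {R : realType} {k : lattice_kind} {d : nat} {F : finType}.
Context {F2 : (1 < #|F|)%N}.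
Local Notation Sigma := (config R k d F2).
Variables (a b : F).
Hypothesis ab : a != b.
Hypothesis d0 : (0 < d)%N.

Definition period (j : nat) : nat := (2 ^ j.+1)%N.
Definition background (j : nat) : F := if odd j then b else a.
Definition impurity (j : nat) : F := if odd j then a else b.

Lemma period_gt0 j : (0 < period j)%N.
Proof. by rewrite expn_gt0. Qed.

Lemma periodS j : period j.+1 = (2 * period j)%N.
Proof. by rewrite /period expnS. Qed.

Lemma period_dvdn i j : (i <= j)%N -> (period i %| period j)%N.
Proof. by move=> ij; rewrite dvdn_exp2l. Qed.

Lemma background_impurity j : background j != impurity j.
Proof. by rewrite /background /impurity; case: odd => //; rewrite eq_sym. Qed.

(* Entropy of the random sparse configurations of level [j]. *)
Definition rate (j : nat) : R := ln 2 / (period j)%:R ^+ d.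

Lemma rate_gt0 j : 0 < rate j.
Proof. by rewrite divr_gt0 ?ln_gt0 ?ltr1n// exprn_gt0// ltr0n period_gt0. Qed.

(** Both the energy lost by the comparison measure and the window error are held below this value;
    the constant 4 makes [2 * (slack j + slack j) / rate j] equal to [1 / j.+1]. *)
Definition slack (j : nat) : R := rate j / (4 * j.+1%:R).

Lemma slack_gt0 j : 0 < slack j.
Proof. by rewrite divr_gt0 ?rate_gt0// mulr_gt0// ltr0n. Qed.

(** The windows depend on the dimension only, so the penalties can afterwards be tuned to them. *)
Lemma windows_exist : exists M : nat -> nat, forall j,
  [/\ (0 < M j)%N, (2 * period j %| M j)%N &
      (ln 3 + d%:R * ln (2 * period j)%N%:R) / (M j)%:R ^+ d <= slack j].
Proof.
have h j : exists M, [/\ (0 < M)%N, (2 * period j %| M)%N &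
    (ln 3 + d%:R * ln (2 * period j)%N%:R) / M%:R ^+ d <= slack j].
  apply: exists_window => //; [|exact: slack_gt0|by rewrite muln_gt0 period_gt0].
  by rewrite addr_ge0 ?mulr_ge0// ln_ge0// ler1n// muln_gt0 period_gt0.
by have [M HM] := choice h; exists M.
Qed.

Variable M : nat -> nat.
Hypothesis HM : forall j,
  [/\ (0 < M j)%N, (2 * period j %| M j)%N &
      (ln 3 + d%:R * ln (2 * period j)%N%:R) / (M j)%:R ^+ d <= slack j].

Definition phase_class j (x : Sigma) : option bool :=
  @word_class k d F (background j) (impurity j) (period j) (2 * period j) (M j)
    (box_word (M j) x).

Definition illegal j (x : Sigma) : bool := phase_class j x == None.

Lemma illegal_agree j x y : agree (M j).+1 x y -> illegal j x = illegal j y.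
Proof.
by move=> xy; rewrite /illegal /phase_class (agree_box_word xy (leqnn _)).
Qed.

(** At a level [i] of the same parity as [j], the configuration is sparse with the favoured
    background. At one of opposite parity it is a competitor, and [i < j] gives that the allowed
    period [2 * period i = period i.+1] divides [period j]. *)
Lemma illegal_sparsify i j v x : (i <= j)%N ->
  ~~ illegal i (@sparsify R k d F F2 (background j) (impurity j) (period j) v x).
Proof.
move=> ij; rewrite /illegal /phase_class /word_class.
have [oij|oij] := eqVneq (odd i) (odd j).
  have -> : background i = background j by rewrite /background oij.
  have -> : impurity i = impurity j by rewrite /impurity oij.
  by rewrite (sparsify_sparse _ _ _ _ _ (period_gt0 i) (period_dvdn ij) (period_gt0 j)).
have -> : background i = impurity j.
  by move: oij; rewrite /background /impurity; case: (odd i); case: (odd j).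
have -> : impurity i = background j.
  by move: oij; rewrite /background /impurity; case: (odd i); case: (odd j).
have ij' : (i < j)%N by rewrite ltn_neqAle ij andbT; apply: contra oij => /eqP ->.
case: ifP => // _.
have N20 : (0 < 2 * period i)%N by rewrite muln_gt0 period_gt0.
rewrite (sparsify_sparse _ _ _ _ _ N20 _ (period_gt0 j))//.
by rewrite -periodS period_dvdn.
Qed.

Lemma measurable_illegal j : measurable [set x | illegal j x].
Proof.
apply: (@determined_measurable _ _ _ _ _ (M j).+1) => x y xy /=.
by rewrite (illegal_agree xy).
Qed.

(** One half of the bound is the density of impurities in favoured windows, at most
    [1 / period j ^ d]; the other is the probability of the remaining windows, controlled by
    [slack]. *)
Lemma equilibrium_background (h : Sigma -> R) (rho : invariant_measure R k d F2) j :
  measurable_fun setT h -> (forall x, h x <= 0) ->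
  (forall x, illegal j x -> h x <= - ln #|F|%:R) ->
  (forall x, (forall i, (i <= j)%N -> ~~ illegal i x) -> - slack j <= h x) ->
  equilibrium_state h rho ->
  fine (rho [set x | x 0 != background j]) <= 2 / j.+1%:R.
Proof.
move=> mh h0 hI hY Hrho.
have [nu [nuY nuH]] := @sparse_measure R k d F F2 _ _ (period j)
   (background_impurity j) (period_gt0 j).
have [Mj0 Mjd Mjs] := HM j.
pose Y := \bigcap_(i in [set i | (i <= j)%N]) ~` [set x | illegal i x].
have mY : measurable Y.
  by apply: bigcap_measurable => [|i _]; [exists 0%N|apply: measurableC; exact: measurable_illegal].
have hI' x : @word_class k d F (background j) (impurity j) (period j) (2 * period j) (M j)
    (box_word (M j) x) = None -> h x <= - ln #|F|%:R.
  by move=> xI; apply: hI; rewrite /illegal /phase_class xI.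
have Y1 : nu Y = 1%E.
  by apply: nuY => // v x i /= ij; apply/negP; exact: illegal_sparsify.
have hY' x : Y x -> - slack j <= h x.
  by move=> Yx; apply: hY => i ij; apply/negP; exact: Yx.
have H := equilibrium_class_bound d0 (period_gt0 j) Mj0 Mjd mh h0 hI' mY Y1 hY'
  (sparse_entropy_ge (period_gt0 j) nuH) Hrho.
have Mjd' : (period j %| M j)%N by apply: dvdn_trans Mjd; exact: dvdn_mull.
apply: le_trans (density_le rho (background j) (impurity j) (2 * period j) Mj0
   (period_gt0 j) Mjd') _.
have P0 : 0 < (period j)%:R :> R by rewrite ltr0n period_gt0.
have j0 : 0 < j.+1%:R :> R by rewrite ltr0n.
rewrite [leRHS](_ : _ = j.+1%:R^-1 + j.+1%:R^-1); last by rewrite -mulr2n mulr_natl.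
apply: lerD.
  rewrite lef_pV2 ?posrE ?exprn_gt0// -natrX ler_nat.
  apply: (@leq_trans (period j)); first by apply: ltnW; rewrite /period ltn_expl.
  by rewrite -[X in (X <= _)%N]expn1 leq_pexp2l// period_gt0.
apply: le_trans H _.
rewrite -/(rate j) ler_pdivrMr ?rate_gt0//.
apply: (@le_trans _ _ (2 * (slack j + slack j))).
  by rewrite ler_pM2l// lerD2l.
rewrite /slack (_ : 2 * _ = rate j / j.+1%:R); first by rewrite mulrC.
by field; rewrite addrC natr1 pnatr_eq0.
Qed.

End Phases.

(** * Alternation of the two backgrounds along the sequence *)

Lemma cluster_along_levels (R : realType) (k : lattice_kind) (d : nat) (F : finType)
    (F2 : (1 < #|F|)%N) (rho : nat -> invariant_measure R k d F2) (f : F) (u : nat -> nat) :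
  (forall n, (n <= u n)%N) ->
  (forall n, fine (rho (u n) [set x | x 0 != f]) <= 2 / n.+1%:R) ->
  cluster (rho l @[l --> \oo]) (@constant_measure R k d F F2 f).
Proof.
move=> nu_ uf; apply: (cluster_constant_measure nu_).
apply: (@squeeze_cvgr _ _ _ _ (fun=> 0) (fun n => 2 * harmonic n)).
- by apply: nearW => n; rewrite fine_prob_ge0 uf.
- exact: cvg_cst.
- by rewrite -[X in _ --> X](mulr0 2); apply: cvgMl_tmp; exact: cvg_harmonic.
Qed.

Theorem theoremB (R : realType) (k : lattice_kind) (d : nat) (d1 : (1 <= d)%N)
    (F : finType) (F2 : (1 < #|F|)%N) :
  exists (phi0 : config R k d F2 -> R) (Uplus Uminus : set (config R k d F2)),
    [/\ lipschitz_continuous phi0,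
        open Uplus, open Uminus, Uminus = ~` Uplus &
        forall beta : nat -> R,
          (forall l, 0 < beta l) -> beta l @[l --> \oo] --> +oo ->
        forall eps : R, 0 < eps ->
        exists phi : config R k d F2 -> R,
          [/\ lipschitz_continuous phi,
              (lip_norm (fun x => phi x - phi0 x)%R < eps%:E)%E &
              forall rho : nat -> invariant_measure R k d F2,
                (forall l, equilibrium_state (fun x => beta l * phi x) (rho l)) ->
                (exists2 mu : invariant_measure R k d F2,
                   cluster (rho l @[l --> \oo]) mu & supported_on Uplus mu) /\
                (exists2 mu : invariant_measure R k d F2,
                   cluster (rho l @[l --> \oo]) mu & supported_on Uminus mu)]].
Proof.
have /card_gt1P[a [b [_ _ ab]]] := F2.
(* Open and closed, and it separates the two constant configurations. *)
pose U := [set x : config R k d F2 | x 0 = a].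
have dU : determined (site_norm (0 : site k d)).+1 U.
  by move=> x y xy; rewrite /U /= => <-; rewrite xy.
exists (fun=> 0), U, (~` U); split => //.
- apply: le_lt_trans (@lip_norm_le _ _ _ _ _ _ 0 0 _ _ _ _) (ltry _) => //.
    by move=> x; rewrite normr0.
  by move=> x y; rewrite subrr normr0 mul0r.
- exact: determined_open dU.
- exact: determined_open (determinedC dU).
move=> beta beta0 betaoo eps eps0.
have [M HM] := @windows_exist R d d1.
pose C : R := ln #|F|%:R.
have C0 : 0 < C by rewrite ln_gt0// ltr1n.
(* The supremum and the Lipschitz constant of [phi] are each at most [eta], so the norm is at most
   [eps / 2]. *)
pose eta := eps / 4; have eta0 : 0 < eta by rewrite divr_gt0.
pose sl := @slack R d; have sl0 j : 0 < sl j by exact: slack_gt0.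
(* The three terms give in turn the Lipschitz bound at level [j], the monotonicity of [c], and the
   smallness of [c j] at the preceding inverse temperature [p]; the last concerns level [j.-1], and
   vanishes at the start, where [p = 0]. *)
pose X j p := C * 2 ^+ (M j).+1 / eta + p + p * C / sl j.-1.
have [l [ll [l0 lS]]] := fast_subsequence X betaoo.
have XM j p : 0 <= p ->
    [/\ C * 2 ^+ (M j).+1 / eta <= X j p, p <= X j p & p * C / sl j.-1 <= X j p].
  move=> p0; have h1 : 0 <= C * 2 ^+ (M j).+1 / eta.
    by rewrite divr_ge0 ?mulr_ge0 ?exprn_ge0// ltW.
  have h2 : 0 <= p * C / sl j.-1.
    by apply: divr_ge0; [apply: mulr_ge0 => //; exact: ltW|exact: ltW].
  by rewrite /X; split; lra.
have bM j : C * 2 ^+ (M j).+1 / eta <= beta (l j).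
  case: j => [|j]; first by have [h _ _] := XM 0%N 0 (lexx _); exact: le_trans h l0.
  by have [h _ _] := XM j.+1 (beta (l j)) (ltW (beta0 _)); exact: le_trans h (lS j).
pose c j := C / beta (l j).
have c0 j : 0 <= c j by apply: divr_ge0; exact: ltW.
have ceta j : c j * 2 ^+ (M j).+1 <= eta.
  by rewrite /c mulrAC ler_pdivrMr// -ler_pdivrMl// mulrC.
have cS j : c j.+1 <= c j.
  rewrite /c ler_pM2l// lef_pV2 ?posrE//.
  by have [_ h _] := XM j.+1 (beta (l j)) (ltW (beta0 _)); exact: le_trans h (lS j).
have chomo i j : (i <= j)%N -> c j <= c i.
  by move: i j; apply/nonincreasing_seqP.
have csl j : beta (l j) * c j.+1 <= sl j.
  rewrite /c mulrA ler_pdivrMr// -ler_pdivrMl// mulrC.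
  by have [_ _ h] := XM j.+1 (beta (l j)) (ltW (beta0 _)); exact: le_trans h (lS j).
pose D := @illegal R k d F F2 a b M.
pose phi := first_penalty D c.
have Dagree j x y : agree (M j).+1 x y -> D j x = D j y by exact: illegal_agree.
have philip := first_penalty_lip Dagree c0 chomo ceta.
have c0eta : c 0%N <= eta.
  by apply: le_trans (ceta 0%N); rewrite ler_peMr// exprn_ege1// ler1n.
have normphi x : `|phi x| <= eta.
  exact: le_trans (first_penalty_norm D c0 chomo x) c0eta.
have lipphi := lip_norm_le (ltW eta0) (ltW eta0) normphi philip.
have mphi : measurable_fun setT phi.
  by apply: continuous_measurable_config; exact: lipschitz_bound_continuous philip.
exists phi; split.
- exact: le_lt_trans lipphi (ltry _).
- rewrite (_ : (fun x => _) = phi); last by apply/funext => x; rewrite subr0.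
  by apply: le_lt_trans lipphi _; rewrite lte_fin /eta; lra.
move=> rho rhoE.
have bound j : fine (rho (l j) [set x | x 0 != background a b j]) <= 2 / j.+1%:R.
  apply: (equilibrium_background ab d1 HM _ _ _ _ (rhoE (l j))).
  - by apply: measurable_funM => //; exact: measurable_cst.
  - by move=> x; rewrite mulr_ge0_le0 ?first_penalty_le0// ltW.
  - move=> x /(first_penalty_le chomo) H.
    apply: le_trans (ler_wpM2l (ltW (beta0 _)) H) _.
    by rewrite mulrN lerN2 /c mulrCA divff ?gt_eqF// mulr1.
  (* A configuration legal up to level [j] included is charged at most [c j.+1], which [csl] makes
     negligible at [beta (l j)]. *)
  - move=> x xl; rewrite -/(sl j); apply: le_trans (_ : beta (l j) * - c j.+1 <= _).
      by rewrite mulrN lerN2.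
    by rewrite ler_pM2l//; apply: first_penalty_ge => // i; rewrite ltnS; exact: xl.
have odd_bound n m : (n <= m)%N -> 2 / m.+1%:R <= 2 / n.+1%:R :> R.
  by move=> nm; rewrite ler_pM2l// lef_pV2 ?posrE ?ltr0n// ler_nat.
split.
  (* The even levels favour [a], the odd ones below favour [b]; level [n.*2] or [n.*2.+1] satisfies
     in particular the bound for [n]. *)
  exists (@constant_measure R k d F F2 a); last exact: constant_measure_supported.
  apply: (@cluster_along_levels _ _ _ _ _ _ _ (fun n => l n.*2)) => n.
    by rewrite (leq_trans _ (ll _))// -addnn leq_addr.
  have := bound n.*2; rewrite /background odd_double => /le_trans; apply.
  by apply: odd_bound; rewrite -addnn leq_addr.
exists (@constant_measure R k d F F2 b); last first.
  by apply: constant_measure_supported => /= ba; rewrite ba eqxx in ab.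
apply: (@cluster_along_levels _ _ _ _ _ _ _ (fun n => l n.*2.+1)) => n.
  by rewrite (leq_trans _ (ll _))// -addnn leqW// leq_addr.
have := bound n.*2.+1; rewrite /background /= odd_double => /le_trans; apply.
by apply: odd_bound; rewrite -addnn leqW// leq_addr.
Qed.
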